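(* Let $\varphi:\mathbb{R}^n\times\mathbb{R}\to\mathbb{R}^n$ be a flow (continuous, not necessarily differentiable) and let $K$ be an isolated invariant set of $\varphi$. Let $W^u(K)$ be the unstable manifold of $K$, let $S$ be an initial section of $W^u(K)$ and let $W^u_S(K)$ be the corresponding initial part of the unstable manifold, with the subspace topology inherited from $\mathbb{R}^n$. Then the shape index $S(K)$ is $\mathrm{Sh}(W^u_S(K)/S,* )$, that is, the pointed shape of the quotient space $W^u_S(K)/S$ with base point $*=[S]$. Furthermore, if $CS$ is the cone over $S$ (attached to $W^u_S(K)$ along $S$), then $S(K)=\mathrm{Sh}(W^u_S(K)\cup CS,* )$, where $*$ is the vertex of the cone.
   Context: Write $xt$ for $\varphi(x,t)$ and, for $X\subset\mathbb{R}^n$ and $J\subset\mathbb{R}$, $XJ=\{xt: x\in X,\ t\in J\}$. Put $\omega(X)=\bigcap_{t\ge 0}\overline{X[t,+\infty)}$ and $\omega^*(X)=\bigcap_{t\le 0}\overline{X(-\infty,t]}$. A compact invariant set $K$ is isolated if it is the maximal invariant subset of some neighborhood $N$ of itself (an isolating neighborhood). An isolating block is a compact isolating neighborhood $N$ for which there are compact sets $L,L'\subset\partial N$ (the exit and entrance sets) such that: (1) $\partial N=L\cup L'$; (2) for every $x\in L'$ there is $\varepsilon>0$ with $x[-\varepsilon,0)\subset\mathbb{R}^n\setminus N$, and for every $x\in L$ there is $\delta>0$ with $x(0,\delta)\subset\mathbb{R}^n\setminus N$; (3) for every $x\in\partial N\setminus L'$ there is $\varepsilon>0$ with $x[-\varepsilon,0)\subset\mathring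 N$, and for every $x\in\partial N\setminus L$ there is $\delta>0$ with $x(0,\delta]\subset\mathring N$. Standing assumption: every isolated invariant set $K$ is of finite type, i.e. its Čech cohomology groups $\check H^k(K)$ (integer coefficients) are finitely generated for all $k$ and nonzero for only finitely many $k$. The unstable manifold is $W^u(K)=\{x\in\mathbb{R}^n:\ \emptyset\ne\omega^*(x)\subset K\}$. A compact section of $W^u(K)\setminus K$ is a compact set $S\subset W^u(K)\setminus K$ that meets each trajectory contained in $W^u(K)\setminus K$ in exactly one point. $S$ is an initial section if moreover $\omega^*(S)\subset K$. For an initial section $S$, put $I^u_S(K)=S(-\infty,0]$; the set $W^u_S(K)=I^u_S(K)\cup K$ is the corresponding initial part of the unstable manifold. The shape index is $S(K)=\mathrm{Sh}(N/L,[L])$, the pointed shape (in the sense of Borsuk) of $N/L$, where $N$ is any isolating block of $K$ with exit set $L$ (it does not depend on $N$). Convention: a quotient $X/\emptyset$ is the disjoint union of $X$ and a base point, and the cone over $\emptyset$ is its vertex. *)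

(* Defs.v *)
From HB Require Import structures.
From Stdlib Require Relation_Operators.
From mathcomp Require Import all_boot all_order all_algebra.
From mathcomp Require Import generic_quotient.
From mathcomp Require Import all_classical all_reals all_analysis.
Import numFieldNormedType.Exports.
Import Order.TTheory GRing.Theory Num.Theory.

Set Implicit Arguments.
Unset Strict Implicit.
Unset Printing Implicit Defensive.

Local Open Scope classical_set_scope.
Local Open Scope ring_scope.
Local Open Scope quotient_scope.

(** * Quotient spaces and cones *)

Section generated_equivalence.
Context {T : topologicalType} (r : T -> T -> Prop).

Let gen : rel T :=
  fun x y => `[< Relation_Operators.clos_refl_sym_trans T r x y >].

Let gen_refl : reflexive gen.
Proof. by move=> x; apply/asboolP; exact: Relation_Operators.rst_refl. Qed.

Let gen_sym : symmetric gen.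
Proof.
by move=> x y; apply/idP/idP => /asboolP h; apply/asboolP;
  exact: Relation_Operators.rst_sym.
Qed.

Let gen_trans : transitive gen.
Proof.
move=> y x z /asboolP xy /asboolP yz; apply/asboolP.
exact: Relation_Operators.rst_trans xy yz.
Qed.

Definition gen_equiv : equiv_rel T := EquivRel gen gen_refl gen_sym gen_trans.

(* The quotient space of [T] by the equivalence relation generated by [r]. *)
Definition glue := {eq_quot gen_equiv}.

HB.instance Definition _ := Topological.copy glue (quotient_topology glue).
HB.instance Definition _ := Quotient.on glue.

Definition glue_pi (x : T) : glue := \pi_glue x.

End generated_equivalence.

(* The topological sum of [X] ([true]) and [Y] ([false]). *)
Definition tsum_fam (X Y : topologicalType) (b : bool) : topologicalType :=
  if b then X else Y.
Definition tsum (X Y : topologicalType) : topologicalType :=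
  {b : bool & tsum_fam X Y b}.
Definition tinl (X Y : topologicalType) (x : X) : tsum X Y :=
  existT (tsum_fam X Y) true x.
Definition tinr (X Y : topologicalType) (y : Y) : tsum X Y :=
  existT (tsum_fam X Y) false y.

Definition one_point : topologicalType := discrete_topology unit.

(* [X / A] is obtained from the disjoint union of [X] and a point by
   identifying every element of [A] with that point: when [A] is nonempty this
   is the usual quotient, and [X / set0] is [X] with an added base point. *)
Definition collapse_rel (X : topologicalType) (A : set X)
    (u v : tsum X one_point) : Prop :=
  exists2 a, A a & u = tinl one_point a /\ v = tinr X (tt : one_point).
Definition collapse (X : topologicalType) (A : set X) : topologicalType :=
  glue (collapse_rel A).
Definition collapse_pi (X : topologicalType) (A : set X) (x : X) : collapse A :=
  glue_pi (collapse_rel A) (tinl one_point x).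
Definition collapse_base (X : topologicalType) (A : set X) : collapse A :=
  glue_pi (collapse_rel A) (tinr X (tt : one_point)).

Definition unit_itv (R : realType) : topologicalType :=
  set_type (`[0%R, 1%R]%classic : set R).

(* The cone [X * [0, 1] / X * {1}]; its vertex is the base point of the
   collapse, so that the cone over an empty space is its vertex. *)
Definition cone_top (R : realType) (X : topologicalType) :
  set (X * unit_itv R)%type := [set p | set_val p.2 = 1].
Arguments cone_top : clear implicits.
Definition cone (R : realType) (X : topologicalType) : topologicalType :=
  collapse (cone_top R X).
Arguments cone : clear implicits.
Definition cone_vertex (R : realType) (X : topologicalType) : cone R X :=
  collapse_base (cone_top R X).
Arguments cone_vertex : clear implicits.

(* [W] with the cone over its subspace [A] attached: the point [a] of [A] is
   identified with the point [(a, 0)] of the base of the cone. *)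
Definition attach_cone_rel (R : realType) (W : topologicalType) (A : set W)
    (u v : tsum W (cone R A)) : Prop :=
  exists (a : A) (t : unit_itv R), [/\ set_val t = 0,
    u = tinl _ (set_val a) & v = tinr _ (collapse_pi (cone_top R A) (a, t))].
Definition attach_cone (R : realType) (W : topologicalType) (A : set W) :
  topologicalType := glue (@attach_cone_rel R W A).
Arguments attach_cone : clear implicits.
Definition attach_cone_vertex (R : realType) (W : topologicalType)
    (A : set W) : attach_cone R W A :=
  glue_pi (@attach_cone_rel R W A) (tinr _ (cone_vertex R A)).
Arguments attach_cone_vertex : clear implicits.

(** * Pointed shape of compacta, in the sense of Borsuk *)

Definition hilbert_cube (R : realType) : topologicalType :=
  prod_topology (fun _ : nat => unit_itv R).

Section shape.
Context {R : realType}.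
Local Notation Q := (hilbert_cube R).

(* The restrictions to [(U, x0)] of [f] and [g] are homotopic in [(V, y0)],
   through base point preserving maps. *)
Definition phomotopic_in (U : set Q) (x0 : Q) (V : set Q) (y0 : Q)
    (f g : Q -> Q) : Prop :=
  exists H : ((U : Type) * unit_itv R)%type -> Q,
    [/\ continuous H,
        forall u t, set_val t = 0 -> H (u, t) = f (set_val u),
        forall u t, set_val t = 1 -> H (u, t) = g (set_val u),
        forall u t, V (H (u, t)) &
        forall u t, set_val u = x0 -> H (u, t) = y0].

Definition fundamental_sequence (X : set Q) (x0 : Q) (Y : set Q) (y0 : Q)
    (f : nat -> Q -> Q) : Prop :=
  [/\ forall k, continuous (f k),
      forall k, f k x0 = y0 &
      forall V, set_nbhs Y V -> exists2 U, set_nbhs X U &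
        \forall k \near \oo, phomotopic_in U x0 V y0 (f k) (f k.+1)].

Definition fundamental_homotopic (X : set Q) (x0 : Q) (Y : set Q) (y0 : Q)
    (f g : nat -> Q -> Q) : Prop :=
  forall V, set_nbhs Y V -> exists2 U, set_nbhs X U &
    \forall k \near \oo, phomotopic_in U x0 V y0 (f k) (g k).

Definition fundamental_equivalent (X : set Q) (x0 : Q) (Y : set Q) (y0 : Q) :
    Prop :=
  exists f g : nat -> Q -> Q,
    [/\ fundamental_sequence X x0 Y y0 f,
        fundamental_sequence Y y0 X x0 g,
        fundamental_homotopic X x0 X x0 (fun k => g k \o f k) (fun=> id) &
        fundamental_homotopic Y y0 Y y0 (fun k => f k \o g k) (fun=> id)].

Definition cube_embedding (X : topologicalType) (i : X -> Q) : Prop :=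
  [/\ injective i, continuous i &
      forall A : set X, open A -> exists2 B, open B & A = i @^-1` B].

End shape.

(* [Sh(X, x0) = Sh(Y, y0)]. Borsuk's relation is defined for compacta lying in
   the Hilbert cube, and transported along embeddings of compact metrizable
   spaces (on which it does not depend). A space with an embedding in the cube
   being metrizable, the relation only holds between compact metrizable
   spaces. *)
Definition same_shape (R : realType) (X : topologicalType) (x0 : X)
    (Y : topologicalType) (y0 : Y) : Prop :=
  [/\ compact [set: X], compact [set: Y] &
    exists (i : X -> hilbert_cube R) (j : Y -> hilbert_cube R),
      [/\ cube_embedding i, cube_embedding j &
          fundamental_equivalent (range i) (i x0) (range j) (j y0)]].
Arguments same_shape : clear implicits.

(** * Cech cohomology with integer coefficients *)

Section cech.
Context {X : topologicalType}.
Implicit Types (U V W : set (set X)) (k : nat).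

Definition open_cover U : Prop :=
  U `<=` open /\ \bigcup_(A in U) A = [set: X].

(* Ordered simplices of the nerve of [U], with possible repetitions. *)
Definition nerve U k (s : 'I_k.+1 -> set X) : Prop :=
  (forall i, U (s i)) /\ \bigcap_i s i !=set0.

(* Only the values on the nerve of the cover under consideration matter. *)
Definition cochain k := ('I_k.+1 -> set X) -> int.

Definition coboundary k (c : cochain k) : cochain k.+1 :=
  fun s => \sum_(i < k.+2) (-1) ^+ i * c (s \o lift i).

Definition is_cocycle U k (c : cochain k) : Prop :=
  forall s, nerve U s -> coboundary c s = 0.

Definition is_coboundary U k : cochain k -> Prop :=
  match k with
  | 0 => fun c => forall s, nerve U s -> c s = 0
  | k'.+1 => fun c => exists b : cochain k',
      forall s, nerve U s -> c s = coboundary b s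
  end.

Definition refinement W U (p : set X -> set X) : Prop :=
  forall A, W A -> U (p A) /\ A `<=` p A.

Definition pullback (p : set X -> set X) k (c : cochain k) : cochain k :=
  fun s => c (p \o s).

(* A class in the k-th Cech group, the direct limit of the cohomology groups of
   the nerves of the open covers, is represented by a cocycle [c] on the nerve
   of a cover [U]. A linear relation holds between such classes if and only if
   it holds, up to a coboundary, on the nerve of some common refinement. *)
Definition cech_trivial k : Prop :=
  forall U (c : cochain k), open_cover U -> is_cocycle U c ->
  exists W p, [/\ open_cover W, refinement W U p &
                  is_coboundary W (pullback p c)].

Definition cech_finitely_generated k : Prop :=
  exists (m : nat) (U : 'I_m -> set (set X)) (c : 'I_m -> cochain k),
    (forall i, open_cover (U i) /\ is_cocycle (U i) (c i)) /\
    forall V (d : cochain k), open_cover V -> is_cocycle V d ->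
    exists (a : 'I_m -> int) (W : set (set X))
           (p : 'I_m -> set X -> set X) (q : set X -> set X),
      [/\ open_cover W, forall i, refinement W (U i) (p i),
          refinement W V q &
          is_coboundary W (fun s =>
            pullback q d s - \sum_(i < m) a i * pullback (p i) (c i) s)].

End cech.
Arguments cech_trivial : clear implicits.
Arguments cech_finitely_generated : clear implicits.

Definition finite_type (X : topologicalType) : Prop :=
  (forall k, cech_finitely_generated X k) /\
  exists m, forall k, (m < k)%N -> cech_trivial X k.

(** * Flows on R^n *)

Section flows.
Context {R : realType} {n : nat}.
Local Notation E := ('rV[R]_n).
Implicit Types (phi : E * R -> E) (K M N L S X : set E) (J : set R).

Definition is_flow phi : Prop :=
  [/\ continuous phi, forall x, phi (x, 0) = x &
      forall x s t, phi (phi (x, s), t) = phi (x, s + t)].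

Definition flow_image phi X J : set E := phi @` (X `*` J).

Definition omega_star phi X : set E :=
  \bigcap_(t in [set t : R | t <= 0]) closure (flow_image phi X `]-oo, t]).

Definition invariant_set phi K : Prop := flow_image phi K setT = K.

Definition isolating_neighborhood phi K N : Prop :=
  [/\ set_nbhs K N, invariant_set phi K, K `<=` N &
      forall M, invariant_set phi M -> M `<=` N -> M `<=` K].

Definition isolated_invariant_set phi K : Prop :=
  [/\ compact K, invariant_set phi K &
      exists N, isolating_neighborhood phi K N].

Definition boundary N : set E := closure N `\` N°.

Record isolating_block phi K N L L' : Prop := IsolatingBlock {
  block_isolating : isolating_neighborhood phi K N;
  block_compact : compact N;
  block_exit_compact : compact L;
  block_entrance_compact : compact L';
  block_boundary : boundary N = L `|` L';
  block_entrance : forall x, L' x ->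
    exists2 e : R, 0 < e & flow_image phi [set x] `[- e, 0[ `<=` ~` N;
  block_exit : forall x, L x ->
    exists2 d : R, 0 < d & flow_image phi [set x] `]0, d[ `<=` ~` N;
  block_not_entrance : forall x, (boundary N `\` L') x ->
    exists2 e : R, 0 < e & flow_image phi [set x] `[- e, 0[ `<=` N°;
  block_not_exit : forall x, (boundary N `\` L) x ->
    exists2 d : R, 0 < d & flow_image phi [set x] `]0, d] `<=` N° }.

Definition unstable_manifold phi K : set E :=
  [set x | omega_star phi [set x] !=set0 /\ omega_star phi [set x] `<=` K].

Definition compact_section phi K S : Prop :=
  [/\ compact S, S `<=` unstable_manifold phi K `\` K &
      forall x, flow_image phi [set x] setT `<=` unstable_manifold phi K `\` K ->
        exists! s, S s /\ flow_image phi [set x] setT s].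

Definition initial_section phi K S : Prop :=
  compact_section phi K S /\ omega_star phi S `<=` K.

Definition initial_part phi K S : set E :=
  flow_image phi S `]-oo, 0] `|` K.

(* [S(K) = Sh(Y, y0)]: the shape index of [K] is the pointed shape of [N / L]
   for any isolating block [N] of [K] with exit set [L]. *)
Definition shape_index_is phi K (Y : topologicalType) (y0 : Y) : Prop :=
  forall N L L', isolating_block phi K N L L' ->
  same_shape R (collapse [set x : N | L (set_val x)])
    (collapse_base [set x : N | L (set_val x)]) Y y0.

End flows.
Arguments shape_index_is {R n} phi K Y y0.

(* Main.v *)
Require Import Defs.
From mathcomp Require Import all_boot all_order all_algebra.
From mathcomp Require Import lra.
From mathcomp Require Import all_classical all_reals all_analysis.
Import numFieldNormedType.Exports.
Import Order.TTheory GRing.Theory Num.Theory.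
Local Open Scope classical_set_scope.
Local Open Scope ring_scope.

(** Let [N] be an isolating block of [K] with exit set [L].  A point of [N] can leave
    [N] only by crossing [L], so stopping every orbit when it meets [L] turns the flow
    into a semiflow on [N / L] that fixes the base point.  By compactness of [N] this
    semiflow attracts the whole of [N / L], uniformly, to the image of the set [A] of
    the points of [N] whose entire past lies in [N] ([asymptotic_attraction]).  The set
    [A] consists of [K] and of backward orbits in the unstable manifold.

    Pushed far enough back in time, an initial section [S] lies in [A \ K], and so does
    its past; the initial part [W] becomes a closed subset of [A], and what remains of
    [A] is the bounded piece between [S] and the exit set, which the flow crosses
    before some time [c].  Hence there are two maps: [G], from [W / S] to [N / L], runs
    the semiflow for the time [c]; the other collapses, in the image of [A], all that
    lies beyond [S].  Their two composites are the time [c] maps of the stopped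
    semiflows, hence are homotopic to the identity.  The second map is only defined on
    the attractor, so on [N / L] it is replaced by running the semiflow for a long time
    [k] first and collapsing afterwards; this gives maps with values close to, but not
    in, [W / S], and shape theory is what makes of them an inverse of [G].

    In the sense of Borsuk, everything happens in the Hilbert cube [Q].  Explicit
    functions collapse [N] along [L] and [A] along what lies beyond [S]
    ([collapsing_map]); maps and homotopies between compacta of [Q] extend by the Tietze
    theorem, as [Q] is a product of intervals.  The delicate point is that a fundamental
    sequence needs, for each neighborhood of the target, one neighborhood of the source
    that serves for all large [k] ([fundamental_sequence_extension]).  The abstract
    shift equivalence is [shape_shift_equivalence], and
    [block_section_equivalent] checks its hypotheses for the flow.

    For the cone, let [S1] be [S] pushed forward by the time [1].  The orbit segments from
    [S] to [S1] form a copy of [S * [0, 1]], so [W] with the cone over [S] attached is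
    homeomorphic to the quotient by [S1] of the initial part defined by [S1].  After a
    further translation by the flow, the same compactum of [Q] represents [W / S] and
    [W] with the cone ([initial_part_collapse] and [initial_part_cone]), so that one
    fundamental equivalence proves both claims. *)

Set Implicit Arguments.
Unset Strict Implicit.
Unset Printing Implicit Defensive.

(** * Maps into the Hilbert cube *)

Definition point_of (T : Type) (A : set T) (x : T) (Ax : A x) : set_type A :=
  exist (fun x => x \in A) x (mem_set Ax).

Section cube.
Context {R : realType}.
Local Notation I := (unit_itv R).
Local Notation Q := (hilbert_cube R).

Lemma unit_itvP (i : I) : 0 <= set_val i <= 1.
Proof. by have := set_valP i; rewrite /= in_itv. Qed.

Lemma clamp_proof (x : R) :
  (`[0%R, 1%R]%classic : set R) (Num.max 0 (Num.min x 1)).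
Proof.
by rewrite /= in_itv/= le_max lexx/= ge_max ler01 ge_min lexx orbT.
Qed.

Definition clamp (x : R) : I := point_of (clamp_proof x).

Lemma clampE (x : R) : set_val (clamp x) = Num.max 0 (Num.min x 1).
Proof. by []. Qed.

Lemma clampK (x : R) : 0 <= x <= 1 -> set_val (clamp x) = x.
Proof. by move=> /andP[x0 x1]; rewrite clampE min_l// max_r. Qed.

Lemma unit_itv_inj (i j : I) : set_val i = set_val j -> i = j.
Proof. by move=> ij; apply: val_inj. Qed.

Lemma set_valK (i : I) : clamp (set_val i) = i.
Proof. by apply: unit_itv_inj; rewrite clampK// unit_itvP. Qed.

Lemma cvg_set_val (T : topologicalType) (A : set T) (U : Type) (F : set_system U)
    (f : U -> set_type A) (x : set_type A) : Filter F ->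
  (f @ F --> x) <-> ((fun u => set_val (f u)) @ F --> set_val x).
Proof.
move=> FF; split=> [fx|fx].
  exact: (cvg_comp _ _ fx (@initial_continuous (set_type A) T set_val x)).
move=> B [C [[D oD <-] Dx] CB].
apply: filterS CB _; apply: fx.
exact: open_nbhs_nbhs.
Qed.

Lemma continuous_set_val (T : topologicalType) (A : set T) :
  continuous (set_val : set_type A -> T).
Proof. exact: initial_continuous. Qed.

Lemma cvg_cube (U : Type) (F : set_system U) (f : U -> Q) (x : Q) : Filter F ->
  (f @ F --> x) <-> (forall n, (fun u => set_val (f u n)) @ F --> set_val (x n)).
Proof.
move=> FF; split=> [fx n|fx].
  apply/cvg_set_val; exact: (cvg_comp _ _ fx (@proj_continuous nat (fun _ => I) n x)).
apply/cvg_sup => n B [C [[D oD <-] Dx] CB].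
apply: filterS CB _.
have /cvg_set_val/(_ D) := fx n; apply.
exact: open_nbhs_nbhs.
Qed.

Lemma continuous_cube (U : topologicalType) (f : U -> Q) :
  continuous f <-> (forall n, continuous (fun u => set_val (f u n))).
Proof.
by split=> [cf n x|cf x]; [exact: (cvg_cube f (f x) (nbhs_filter x)).1 (cf x) n|apply/cvg_cube => n; exact: cf].
Qed.

Lemma continuous_coord n : continuous (fun q : Q => set_val (q n)).
Proof. exact: ((continuous_cube (id : Q -> Q)).1 (fun x => cvg_id)). Qed.

Lemma cvg_clamp (U : Type) (F : set_system U) (f : U -> R) (x : R) : Filter F ->
  f @ F --> x -> (fun u => clamp (f u)) @ F --> clamp x.
Proof.
move=> FF fx; apply/cvg_set_val; rewrite clampE.
under eq_fun do rewrite clampE.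
have c : continuous (fun y : R => Num.max 0 (Num.min y 1)).
  move=> y; exact: (@continuous_max R R (fun=> 0) (fun z => Num.min z 1) y
    (cvg_cst _) (@continuous_min R R id (fun=> 1) y cvg_id (cvg_cst _))).
exact: (cvg_comp _ _ fx (c x)).
Qed.

Lemma continuous_clamp : continuous clamp.
Proof. by move=> x; apply: cvg_clamp; exact: cvg_id. Qed.

(** All maps into the cube below are given by sequences of real functions, clamped to
    [0, 1]: continuity is then a matter of real arithmetic, and no gluing is needed. *)
Lemma continuous_clamp_cube (U : topologicalType) (f : nat -> U -> R) :
  (forall n, continuous (f n)) -> continuous (fun u => (fun n => clamp (f n u)) : Q).
Proof.
move=> cf u; apply: (cvg_cube _ _ (nbhs_filter u)).2 => n.
apply: (cvg_set_val (fun v => clamp (f n v)) (clamp (f n u)) (nbhs_filter u)).1.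
by apply: cvg_clamp; exact: cf.
Qed.

Lemma compact_set_type (T : topologicalType) (A : set T) :
  compact A -> compact [set: set_type A].
Proof.
move=> cA F PF _.
have [|x [Ax Fx]] := cA (set_val @ F) _.
  by rewrite nbhs_simpl; apply: (@filterE _ F) => y; exact: set_valP.
exists (point_of Ax); split=> // B C FB [D [[E oE <-] Ex] DC].
have [y [[z Bz <-] Ez]] : (set_val @` B) `&` E !=set0.
  apply: Fx; last exact: open_nbhs_nbhs.
  by rewrite nbhs_simpl; apply: (@filterS _ F _ B) => // z Bz; exists z.
by exists z; split=> //; exact: DC.
Qed.

Lemma hausdorff_set_type (T : topologicalType) (A : set T) :
  hausdorff_space T -> hausdorff_space (set_type A).
Proof.
move=> hT x y xy; apply: val_inj; apply: hT => B C nB nC.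
have [||z [Bz Cz]] := xy (set_val @^-1` B) (set_val @^-1` C).
- exact: continuous_set_val.
- exact: continuous_set_val.
by exists (set_val z).
Qed.

Lemma unit_itv_compact : compact [set: I].
Proof. exact/compact_set_type/segment_compact. Qed.

Lemma unit_itv_hausdorff : hausdorff_space I.
Proof. exact/hausdorff_set_type/Rhausdorff. Qed.

Lemma cube_compact : compact [set: Q].
Proof.
have := @tychonoff nat (fun=> I) (fun=> setT) (fun=> unit_itv_compact).
by congr compact; apply/seteqP; split.
Qed.

Lemma cube_hausdorff : hausdorff_space Q.
Proof. exact: (@hausdorff_product nat (fun=> I) (fun=> unit_itv_hausdorff)). Qed.

Lemma hausdorff_prod (T U : topologicalType) :
  hausdorff_space T -> hausdorff_space U -> hausdorff_space (T * U)%type.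
Proof.
move=> hT hU [x1 y1] [x2 y2] xy; congr pair.
  apply: hT => B C nB nC.
  have [||[z w] [Bz Cz]] := xy (fst @^-1` B) (fst @^-1` C).
  - exact: cvg_fst.
  - exact: cvg_fst.
  by exists z.
apply: hU => B C nB nC.
have [||[z w] [Bz Cz]] := xy (snd @^-1` B) (snd @^-1` C).
- exact: cvg_snd.
- exact: cvg_snd.
by exists w.
Qed.

(** Tietze on each coordinate; the extension of a coordinate is bounded by [1] in absolute
    value but may be negative, whence the clamping. *)
Lemma cube_extension (Z : topologicalType) (A : set Z) (f : set_type A -> Q) :
  hausdorff_space Z -> compact [set: Z] -> closed A -> continuous f ->
  exists2 F : Z -> Q, continuous F & forall a, F (set_val a) = f a.
Proof.
move=> hZ cZ clA cf; have nZ := compact_normal hZ cZ.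
pose f' n : Z -> R := valL_ (0 : R) (fun a => set_val (f a n)).
have /choice[F FP] n : exists F : Z -> R,
    continuous F /\ forall a, F (set_val a) = set_val (f a n).
  have [|||F [fF cF _]] := @continuous_bounded_extension Z R nZ A clA (f' n) 1.
  - by [].
  - apply/subspace_valL_continuousP'.
    exact: ((continuous_cube f).1 cf n).
  - move=> x Ax; have -> : f' n x = set_val (f (point_of Ax) n).
      by rewrite -[LHS]/(sigL A (f' n) (point_of Ax)) /f' valLK.
    by have /andP[f0 f1] := unit_itvP (f (point_of Ax) n); rewrite ger0_norm.
  exists F; split=> // a; rewrite -fF; last by rewrite inE; exact: set_valP.
  by rewrite -[LHS]/(sigL A (f' n) a) /f' valLK.
exists (fun z n => clamp (F n z)).
  by apply: continuous_clamp_cube => n; exact: (FP n).1.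
move=> a; apply: functional_extensionality_dep => n.
by rewrite (FP n).2 set_valK.
Qed.
End cube.

(** * Continuity and compactness *)

Section compact_lemmas.

Lemma continuous_pair (T U V : topologicalType) (f : T -> U) (g : T -> V) :
  continuous f -> continuous g -> continuous (fun x => (f x, g x)).
Proof. by move=> cf cg x; apply: cvg_pair; [exact: cf|exact: cg]. Qed.

Lemma continuous_compose (T U V : topologicalType) (f : T -> U) (g : U -> V) :
  continuous f -> continuous g -> continuous (fun x => g (f x)).
Proof. by move=> cf cg x; exact: (cvg_comp _ _ (cf x) (cg (f x))). Qed.

Lemma continuous_const (T U : topologicalType) (c : U) : continuous (fun _ : T => c).
Proof. by move=> x; exact: cvg_cst. Qed.

Lemma continuous_idT (T : topologicalType) : continuous (fun x : T => x).
Proof. by move=> x; exact: cvg_id. Qed.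

Lemma continuous_fstT (T U : topologicalType) : continuous (@fst T U).
Proof. by move=> p; exact: cvg_fst. Qed.

Lemma continuous_sndT (T U : topologicalType) : continuous (@snd T U).
Proof. by move=> p; exact: cvg_snd. Qed.

Lemma continuous_point_of (T U : topologicalType) (A : set T) (f : U -> T)
    (Af : forall u, A (f u)) :
  continuous f -> continuous (fun u => point_of (Af u)).
Proof.
move=> cf u; apply: (cvg_set_val (fun u => point_of (Af u)) (point_of (Af u)) (nbhs_filter u)).2.
exact: cf.
Qed.

(** The tube lemma *)
Lemma near_forall_compact (T C : topologicalType) (Z : topologicalType)
    (H : T * C -> Z) (x : T) (V : set Z) :
  compact [set: C] -> continuous H -> (forall c, nbhs (H (x, c)) V) ->
  \forall u \near x, forall c, V (H (u, c)).
Proof.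
move=> cC cH HV.
have HN := (compact_near_coveringP [set: C]).1 cC T (nbhs x)
  (fun u c => V (H (u, c))) (nbhs_filter x).
apply: filterS (HN _) => [u /(_ _ I) h c|c _]; first exact: h.
have := cH (x, c) V (HV c).
case=> -[A B] /= [nA nB] AB; exists (B, A) => //= -[c' u] [Bc Au].
exact: (AB (u, c')).
Qed.

End compact_lemmas.

(** * Pointed homotopies and fundamental sequences *)

Section homotopy.
Context {R : realType}.
Local Notation I := (unit_itv R).
Local Notation Q := (hilbert_cube R).
Implicit Types (X Y U V : set Q).

Lemma continuous_subR (T : topologicalType) (f g : T -> R) :
  continuous f -> continuous g -> continuous (fun x => f x - g x).
Proof. by move=> cf cg x; exact: (cvgB (cf x) (cg x)). Qed.

Lemma continuous_addR (T : topologicalType) (f g : T -> R) :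
  continuous f -> continuous g -> continuous (fun x => f x + g x).
Proof. by move=> cf cg x; exact: (cvgD (cf x) (cg x)). Qed.

Lemma continuous_mulR (T : topologicalType) (f g : T -> R) :
  continuous f -> continuous g -> continuous (fun x => f x * g x).
Proof. by move=> cf cg x; exact: (cvgM (cf x) (cg x)). Qed.

Let val (i : I) : R := set_val i.

Let continuous_val : continuous val.
Proof. exact: continuous_set_val. Qed.

Let coord n (q : Q) : R := set_val (q n).

Let continuous_coordn n : continuous (coord n).
Proof. exact: continuous_coord. Qed.

(** Countably many neighborhoods suffice to test convergence to a compact set, so that
    [fundamental_sequence_extension] can treat them one after the other. *)
Lemma cube_compact_nbhs_basis Y :
  compact Y -> exists B : nat -> set Q,
    (forall i, open (B i) /\ Y `<=` B i) /\
    forall W, set_nbhs Y W -> exists i, B i `<=` W.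
Proof.
move=> cY.
pose cyl i (y z : Q) := forall m : 'I_i, `|coord m y - coord m z| < i.+1%:R^-1.
exists (fun i => [set z | exists2 y, Y y & cyl i y z]); split=> [i|W nW].
  split; last first.
    by move=> y Yy; exists y => // m; rewrite subrr normr0 invr_gt0 ltr0n.
  rewrite openE => z [y Yy yz].
  have : nbhs z [set z' | cyl i y z'].
    apply: (@filter_forall _ _ (fun (m : 'I_i) z' => `|coord m y - coord m z'| < i.+1%:R^-1)
      _ (nbhs_filter z)) => m.
    have c : continuous (fun z' => `|coord m y - coord m z'|).
      have cB : continuous (fun z' => coord m y - coord m z').
        exact: continuous_subR (@continuous_const _ _ _) (@continuous_coordn m).
      exact: continuous_compose cB (@norm_continuous R R).
    by have := c z; move/cvgr_lt => /(_ _ (yz m)).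
  by apply: filterS => z' yz'; exists y.
have [i _ Hi] : \forall i \near \oo, Y `<=` (fun y => cyl i y `<=` W).
  apply: ((compact_near_coveringP Y).1 cY nat \oo (fun i y => cyl i y `<=` W)).
  (* [G] describes the points whose first [i] coordinates are [1 / i.+1]-close to
     those of [y'], as [y'] tends to [y] and [i] grows: it converges to [y]. *)
  move=> y Yy; pose G : set_system Q :=
    [set P | \forall y' \near y & i \near \oo, cyl i y' `<=` P].
  have GF : Filter G.
    split=> [|P P' GP GP'|P P' PP' GP].
    - by apply: (@filterE _ (filter_prod (nbhs y) \oo)) => p z.
    - apply: (@filterS2 _ (filter_prod (nbhs y) \oo) _ _ _ _ _ GP GP').
      by move=> p pP pP' z pz; split; [exact: pP|exact: pP'].
    - by apply: (@filterS _ (filter_prod (nbhs y) \oo) _ _ _ _ GP) => p pP z /pP /PP'.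
  have Gy : id @ G --> y.
    apply: (cvg_cube id y GF).2 => m.
    apply/cvgrPdist_lt => e e0; have e20 : 0 < e / 2 by rewrite divr_gt0.
    near=> y' i => z yz /=.
    have mi : (m < i)%N by near: i; exact: nbhs_infty_gt.
    apply: (le_lt_trans (ler_distD (coord m y') _ _)).
    rewrite [ltRHS](splitr e); apply: ltrD.
      near: y'; move/cvgrPdist_lt : (@continuous_coordn m y); exact.
    apply: lt_trans (yz (Ordinal mi)) _.
    by rewrite /=; near: i; exact: (near_infty_natSinv_lt (PosNum e20)).
  exact: Gy (nW y Yy).
exists i => z [y Yy]; exact: (Hi i (leqnn i) y Yy).
Unshelve. all: by end_near. Qed.

(** The Tietze extension [H0] of [h] need not start at [f] nor end at [g]; adding the affine
    interpolation of the two errors corrects this and changes nothing over [X], where both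
    errors vanish. *)
Lemma homotopy_extension X (f g : Q -> Q) (h : (X : Type) * I -> Q) :
  compact X -> continuous f -> continuous g -> continuous h ->
  (forall x t, set_val t = 0 -> h (x, t) = f (set_val x)) ->
  (forall x t, set_val t = 1 -> h (x, t) = g (set_val x)) ->
  exists H : Q * I -> Q, [/\ continuous H,
    forall u t, set_val t = 0 -> H (u, t) = f u,
    forall u t, set_val t = 1 -> H (u, t) = g u &
    forall x t, H (set_val x, t) = h (x, t)].
Proof.
move=> cX cf cg ch h0 h1.
have clX := compact_closed cube_hausdorff cX.
pose A : set (Q * I) := [set p | X p.1].
have clA : closed A by apply: closed_comp clX => p _; exact: cvg_fst.
pose k (p : set_type A) : (X : Type) * I := (@point_of Q X (set_val p).1 (set_valP p), (set_val p).2).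
have ck : continuous k.
  have cv := @continuous_set_val _ A.
  apply: continuous_pair; last exact: continuous_compose cv (@continuous_sndT _ _).
  by apply: continuous_point_of; exact: continuous_compose cv (@continuous_fstT _ _).
have [||||H0 cH0 H0E] := @cube_extension R (Q * I)%type A (h \o k).
- exact: hausdorff_prod cube_hausdorff unit_itv_hausdorff.
- by rewrite -setXTT; exact: compact_setX cube_compact unit_itv_compact.
- exact: clA.
- exact: continuous_compose ck ch.
have {}H0E x t : H0 (set_val x, t) = h (x, t).
  have Ap : A (set_val x, t) by exact: set_valP.
  rewrite -[(set_val x, t)]/(set_val (point_of Ap)) H0E /= /k.
  by congr (h (_, _)); apply: val_inj.
pose F n (p : Q * I) : R := coord n (H0 p) +
  (1 - val p.2) * (coord n (f p.1) - coord n (H0 (p.1, clamp 0))) +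
  val p.2 * (coord n (g p.1) - coord n (H0 (p.1, clamp 1))).
have cF n : continuous (F n).
  have c1 : continuous (fun p : Q * I => coord n (H0 p)).
    exact: continuous_compose cH0 (@continuous_coordn n).
  have c0 (e : Q -> Q) : continuous e -> continuous (fun p : Q * I => coord n (e p.1)).
    move=> ce; apply: continuous_compose (@continuous_coordn n).
    exact: continuous_compose (@continuous_fstT _ _) ce.
  have c2 (i : I) : continuous (fun p : Q * I => coord n (H0 (p.1, i))).
    apply: (c0 (fun q => H0 (q, i))).
    apply: (@continuous_compose _ _ _ (fun q => (q, i)) H0) => //.
    exact: continuous_pair (@continuous_idT _) (@continuous_const _ _ i).
  have cv : continuous (fun p : Q * I => val p.2).
    exact: continuous_compose (@continuous_sndT _ _) continuous_val.
  move=> p; apply: cvgD; first apply: cvgD; first exact: c1.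
    apply: cvgM; first by apply: cvgB; [exact: cvg_cst|exact: cv].
    by apply: cvgB; [exact: c0|exact: c2].
  by apply: cvgM; [exact: cv|apply: cvgB; [exact: c0|exact: c2]].
have valK i (c : R) : val i = c -> i = clamp c by move=> <-; rewrite set_valK.
exists (fun p n => clamp (F n p)); split.
- exact: continuous_clamp_cube.
- move=> u t t0; apply: functional_extensionality_dep => n.
  rewrite /F /= /val t0 (valK t 0 t0) subr0 mul1r mul0r addr0 addrC subrK.
  exact: set_valK.
- move=> u t t1; apply: functional_extensionality_dep => n.
  rewrite /F /= /val t1 (valK t 1 t1) subrr mul1r mul0r addr0 addrC subrK.
  exact: set_valK.
- move=> x t; apply: functional_extensionality_dep => n.
  rewrite /F /= !H0E (h0 x (clamp 0)) ?clampK ?lexx ?ler01//.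
  rewrite (h1 x (clamp 1)) ?clampK ?lexx ?ler01//.
  by rewrite !subrr !mulr0 !addr0; exact: set_valK.
Qed.

(** Time is reparametrized affinely from [a] to [b]; with [b < a] the homotopy is run
    backwards. *)
Lemma phomotopicI (a b : R) X x0 V y0 (f g : Q -> Q) (H : (X : Type) * R -> Q) :
  continuous H ->
  (forall x, H (x, a) = f (set_val x)) -> (forall x, H (x, b) = g (set_val x)) ->
  (forall x t, 0 <= t <= 1 -> V (H (x, (1 - t) * a + t * b))) ->
  (forall x t, set_val x = x0 -> H (x, t) = y0) ->
  phomotopic_in X x0 V y0 f g.
Proof.
move=> cH Ha Hb HV H0; exists (fun p => H (p.1, (1 - val p.2) * a + val p.2 * b)).
split=> [|u t t0|u t t1|u t|u t ux0] /=.
- apply: (@continuous_compose _ _ _ (fun p => (p.1, (1 - val p.2) * a + val p.2 * b)) H) => //.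
  apply: continuous_pair; first exact: continuous_fstT.
  have cv : continuous (fun p : (X : Type) * I => val p.2).
    exact: continuous_compose (@continuous_sndT _ _) continuous_val.
  move=> p; apply: cvgD; apply: cvgM; try exact: cvg_cst; try exact: cv.
  by apply: cvgB; [exact: cvg_cst|exact: cv].
- by rewrite /val t0 subr0 mul1r mul0r addr0.
- by rewrite /val t1 subrr mul0r mul1r add0r.
- exact/HV/unit_itvP.
- exact: H0.
Qed.

(** The concatenation is the sum [H (2 t) + K (2 t - 1) - g], with times clamped to [0, 1]:
    on each half of the interval one of the homotopies rests at [g] and cancels the last
    term. *)
Lemma phomotopic_trans X x0 V y0 (f g h : Q -> Q) :
  phomotopic_in X x0 V y0 f g -> phomotopic_in X x0 V y0 g h ->
  phomotopic_in X x0 V y0 f h.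
Proof.
move=> [H [cH H0 H1 HV Hb]] [K [cK K0 K1 KV Kb]].
pose F n (p : (X : Type) * I) : R :=
  coord n (H (p.1, clamp (2 * val p.2))) +
  coord n (K (p.1, clamp (2 * val p.2 - 1))) - coord n (H (p.1, clamp 1)).
have cF n : continuous (F n).
  have c (e : R -> R) (L : (X : Type) * I -> Q) : continuous e -> continuous L ->
      continuous (fun p : (X : Type) * I => coord n (L (p.1, clamp (e (val p.2))))).
    move=> ce cL; apply: continuous_compose (@continuous_coordn n).
    apply: (@continuous_compose _ _ _ (fun p => (p.1, clamp (e (val p.2)))) L) => //.
    apply: continuous_pair; first exact: continuous_fstT.
    apply: (@continuous_compose _ _ _ (fun p => e (val p.2)) clamp).
      apply: (@continuous_compose _ _ _ (fun p => val p.2) e) => //.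
      exact: (continuous_compose (@continuous_sndT _ _) continuous_val).
    exact: continuous_clamp.
  have c2 : continuous (fun t : R => 2 * t).
    by move=> t; apply: cvgM; [exact: cvg_cst|exact: cvg_id].
  move=> p; apply: cvgB; first apply: cvgD.
  - exact: (c (fun t => 2 * t)).
  - apply: (c (fun t => 2 * t - 1)) => // t.
    by apply: cvgB; [exact: c2|exact: cvg_cst].
  - by apply: (c (fun=> 1)) => // t; exact: cvg_cst.
have v1 : set_val (clamp (1 : R)) = 1 by rewrite clampK// lexx ler01.
have v0 : set_val (clamp (0 : R)) = 0 by rewrite clampK// lexx ler01.
have clamp1 (x : R) : 1 <= x -> clamp x = clamp 1.
  by move=> x1; apply: unit_itv_inj; rewrite !clampE min_r// minxx.
have clamp0 (x : R) : x <= 0 -> clamp x = clamp 0.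
  by move=> x1; apply: unit_itv_inj; rewrite !clampE !max_l// ge_min ?x1 ?lexx.
have KH x : K (x, clamp 0) = H (x, clamp 1) by rewrite K0// H1.
have FE1 x (t : I) : val t <= 2^-1 ->
    (fun n => clamp (F n (x, t))) = H (x, clamp (2 * val t)).
  move=> t2; apply: functional_extensionality_dep => n.
  rewrite /F /= (clamp0 (2 * val t - 1)) ?KH ?addrK; first exact: set_valK.
  by rewrite subr_le0 -ler_pdivlMl// mulr1.
have FE2 x (t : I) : 2^-1 <= val t ->
    (fun n => clamp (F n (x, t))) = K (x, clamp (2 * val t - 1)).
  move=> t2; apply: functional_extensionality_dep => n.
  rewrite /F /= (clamp1 (2 * val t)); last by rewrite -ler_pdivrMl// mulr1.
  by rewrite addrAC subrr add0r; exact: set_valK.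
exists (fun p n => clamp (F n p)); split=> [|u t t0|u t t1|u t|u t ux0].
- exact: continuous_clamp_cube.
- by rewrite FE1 /val t0 ?invr_ge0// mulr0 H0.
- have e21 : 2 * 1 - 1 = 1 :> R by rewrite mulr1 -natr1 addrK.
  by rewrite FE2 /val t1 ?invf_le1// ?ler1n// K1// e21.
- by case: (leP (val t) 2^-1) => [/FE1 ->//|/ltW/FE2 ->].
- by case: (leP (val t) 2^-1) => [/FE1 ->//|/ltW/FE2 ->//]; [exact: Hb|exact: Kb].
Qed.

Lemma phomotopic_sub X x0 V y0 X' V' (f g : Q -> Q) :
  X' `<=` X -> V `<=` V' ->
  phomotopic_in X x0 V y0 f g -> phomotopic_in X' x0 V' y0 f g.
Proof.
move=> XX VV [H [cH H0 H1 HV Hb]].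
have Xi (x : X') : X (set_val x) by exact/XX/set_valP.
exists (fun p => H (point_of (Xi p.1), p.2)).
split=> [|u t t0|u t t1|u t|u t ux0] /=; [|by rewrite H0|by rewrite H1|exact/VV|exact: Hb].
apply: (@continuous_compose _ _ _ (fun p => (point_of (Xi p.1), p.2)) H) => //.
apply: continuous_pair; last exact: continuous_sndT.
apply: continuous_point_of; apply: continuous_compose (@continuous_fstT _ _) _.
exact: continuous_set_val.
Qed.

Lemma phomotopic_precomp X x0 V y0 U u0 (e f g : Q -> Q) : continuous e ->
  (forall u, U u -> X (e u)) -> e u0 = x0 ->
  phomotopic_in X x0 V y0 f g -> phomotopic_in U u0 V y0 (f \o e) (g \o e).
Proof.
move=> ce UX e0 [H [cH H0 H1 HV Hb]].
have Xi (u : U) : X (e (set_val u)) by exact/UX/set_valP.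
exists (fun p => H (point_of (Xi p.1), p.2)).
split=> [|u t t0|u t t1|u t|u t ux0] /=; [|by rewrite H0|by rewrite H1|exact: HV|].
  apply: (@continuous_compose _ _ _ (fun p => (point_of (Xi p.1), p.2)) H) => //.
  apply: continuous_pair; last exact: continuous_sndT.
  apply: (@continuous_point_of _ _ X (fun p : (U : Type) * I => e (set_val p.1))).
  apply: (@continuous_compose _ _ _ fst (fun u : U => e (set_val u))).
    exact: continuous_fstT.
  exact: continuous_compose (@continuous_set_val _ _) ce.
by apply: Hb; rewrite -e0 -ux0.
Qed.

Lemma phomotopic_postcomp X x0 V y0 W z0 (e f g : Q -> Q) : continuous e ->
  (forall v, V v -> W (e v)) -> e y0 = z0 ->
  phomotopic_in X x0 V y0 f g -> phomotopic_in X x0 W z0 (e \o f) (e \o g).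
Proof.
move=> ce VW e0 [H [cH H0 H1 HV Hb]].
exists (fun p => e (H p)).
split=> [|u t t0|u t t1|u t|u t ux0] /=; [|by rewrite H0|by rewrite H1|exact/VW|].
  exact: continuous_compose cH ce.
by rewrite Hb.
Qed.

(** The homotopy extends to the cube, and by the tube lemma the extension stays in the open
    set [V] near [X]. *)
Lemma phomotopic_neighborhood X x0 V y0 (f g : Q -> Q) :
  compact X -> X x0 -> open V -> continuous f -> continuous g ->
  phomotopic_in X x0 V y0 f g ->
  exists2 U, set_nbhs X U & phomotopic_in U x0 V y0 f g.
Proof.
move=> cX Xx0 oV cf cg [h [ch h0 h1 hV hb]].
have [H [cH H0 H1 Hh]] := homotopy_extension cX cf cg ch h0 h1.
exists [set u | forall t, V (H (u, t))].
  move=> x Xx; apply: near_forall_compact unit_itv_compact cH _ => t.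
  apply: open_nbhs_nbhs; split=> //.
  by rewrite -[x]/(set_val (point_of Xx)) Hh.
exists (fun p => H (set_val p.1, p.2)).
split=> [|u t t0|u t t1|u t|u t ux0] /=; [|by rewrite H0|by rewrite H1| |].
- apply: (@continuous_compose _ _ _ (fun p => (set_val p.1, p.2)) H) => //.
  apply: continuous_pair; last exact: continuous_sndT.
  exact: continuous_compose (@continuous_fstT _ _) (@continuous_set_val _ _).
- exact: (set_valP u).
- by rewrite ux0 -[x0]/(set_val (point_of Xx0)) Hh; exact: hb.
Qed.

(** A homotopy of maps defined on [X] is extended to the cube without leaving those of the
    first open sets [B i] that contain it.  Some extension stays in them near [X];
    elsewhere time is stopped by an Urysohn function, so that the point does not move
    from [F u]. *)
Lemma controlled_extension X (F : Q -> Q) (h : (X : Type) * I -> Q)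
    (B : nat -> set Q) (m : nat) :
  compact X -> (forall i, open (B i)) -> continuous F -> continuous h ->
  (forall x t, set_val t = 0 -> h (x, t) = F (set_val x)) ->
  exists J : Q * I -> Q, [/\ continuous J,
    forall u t, set_val t = 0 -> J (u, t) = F u,
    forall x t, J (set_val x, t) = h (x, t) &
    forall i, (i <= m)%N -> (forall p, B i (h p)) ->
      forall u, B i (F u) -> forall t, B i (J (u, t))].
Proof.
move=> cX oB cF ch h0; have clX := compact_closed cube_hausdorff cX.
have [||||g cg gE] := @cube_extension R Q X (fun x => h (x, clamp 1)).
- exact: cube_hausdorff.
- exact: cube_compact.
- exact: clX.
- apply: (@continuous_compose _ _ _ (fun x => (x, clamp 1)) h) => //.
  exact: continuous_pair (@continuous_idT _) (@continuous_const _ _ (clamp 1)).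
have h1 x t : set_val t = 1 -> h (x, t) = g (set_val x).
  by move=> t1; rewrite gE; congr (h (_, _)); apply: unit_itv_inj; rewrite clampK// ler01 lexx.
have [H [cH H0 _ Hh]] := homotopy_extension cX cF cg ch h0 h1.
pose U := [set u | forall i : 'I_m.+1, (forall p, B i (h p)) -> forall t, B i (H (u, t))].
have /set_nbhsP[C [oC XC CU]] : set_nbhs X U.
  move=> x Xx; apply: (@filter_forall _ _ (fun (i : 'I_m.+1) u =>
    (forall p, B i (h p)) -> forall t, B i (H (u, t))) _ (nbhs_filter x)) => i.
  have [hB|nhB] := pselect (forall p, B i (h p)); last by apply: filterE => u /nhB.
  apply: (@filterS _ _ _ [set u | forall t, B i (H (u, t))]) => [u HB _//|].
  apply: near_forall_compact unit_itv_compact cH _ => t.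
  apply: open_nbhs_nbhs; split=> //.
  by rewrite -[x]/(set_val (point_of Xx)) Hh.
have [|chi [cchi chi01 chi0 chi1]] := (@uniform_separatorP Q R (~` C) X).1.
  apply: (normal_separatorP (R := R)).1 => //.
  - exact: compact_normal cube_hausdorff cube_compact.
  - exact: open_closedC.
  - by rewrite -subset0 => u [nC /XC].
exists (fun p => H (p.1, clamp (val p.2 * chi p.1))).
split=> [|u t t0|x t|i im hB u Fu t] /=.
- apply: (@continuous_compose _ _ _ (fun p => (p.1, clamp (val p.2 * chi p.1))) H) => //.
  apply: continuous_pair; first exact: continuous_fstT.
  apply: (@continuous_compose _ _ _ (fun p : Q * I => val p.2 * chi p.1) clamp).
    have c1 := continuous_compose (@continuous_sndT Q I) continuous_val.
    have c2 := continuous_compose (@continuous_fstT Q I) cchi.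
    by move=> p; apply: cvgM; [exact: c1|exact: c2].
  exact: continuous_clamp.
- by rewrite /val t0 mul0r H0// clampK// lexx ler01.
- have -> : chi (set_val x) = 1 by apply: chi1; exists (set_val x) => //; exact: set_valP.
  by rewrite mulr1 set_valK Hh.
- have [Cu|nCu] := pselect (C u).
    by apply: (CU u Cu (Ordinal (im : (i < m.+1)%N))).
  have -> : chi u = 0 by apply: chi0; exists u.
  by rewrite mulr0 H0// clampK// lexx ler01.
Qed.

(** One neighborhood of [X] must serve for all large [k] at once, so the maps [h k (_, 0)]
    cannot be extended to the cube independently of each other.  Here [F k.+1] is the end
    of an extension of [h k] that starts at [F k] and keeps in [B i] what [F k] sends
    there, as soon as [i <= k] and [h k] has its values in [B i].  For [K] large, the
    preimage of [B i] by [F K] is then the required neighborhood. *)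
Lemma fundamental_sequence_extension X x0 Y y0 (h : nat -> (X : Type) * I -> Q) :
  compact X -> compact Y -> X x0 ->
  (forall k, continuous (h k)) ->
  (forall k x, h k (x, clamp 1) = h k.+1 (x, clamp 0)) ->
  (forall k x t, set_val x = x0 -> h k (x, t) = y0) ->
  (forall V, set_nbhs Y V -> exists K, forall k, (K <= k)%N -> forall p, V (h k p)) ->
  exists F, fundamental_sequence X x0 Y y0 F /\
    forall k x, F k (set_val x) = h k (x, clamp 0).
Proof.
move=> cX cY Xx0 ch h10 hb hY.
have v0 : set_val (clamp (0 : R)) = 0 by rewrite clampK// lexx ler01.
have v1 : set_val (clamp (1 : R)) = 1 by rewrite clampK// ler01 lexx.
have [B [BP Bbasis]] := cube_compact_nbhs_basis cY.
have oB i := (BP i).1.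
pose ok k (F : Q -> Q) := continuous F /\ forall x, F (set_val x) = h k (x, clamp 0).
pose T k := {F | ok k F}.
pose link k (F F' : Q -> Q) := exists J : Q * I -> Q, [/\ continuous J,
  forall u t, set_val t = 0 -> J (u, t) = F u,
  forall u t, set_val t = 1 -> J (u, t) = F' u,
  forall x t, J (set_val x, t) = h k (x, t) &
  forall i, (i <= k)%N -> (forall p, B i (h k p)) ->
      forall u, B i (F u) -> forall t, B i (J (u, t))].
have step k (F : T k) : {F' : T k.+1 | link k (sval F) (sval F')}.
  apply: cid; case: F => F [cF Fh] /=.
  have [|J [cJ J0 Jh JB]] := @controlled_extension X F (h k) B k cX oB cF (ch k).
    by move=> x t t0; rewrite Fh; congr (h k (_, _)); apply: unit_itv_inj; rewrite v0.
  have cF' : continuous (fun u => J (u, clamp 1)).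
    apply: (@continuous_compose _ _ _ (fun u => (u, clamp 1)) J) => //.
    exact: continuous_pair (@continuous_idT _) (@continuous_const _ _ (clamp 1)).
  have F'h x : J (set_val x, clamp 1) = h k.+1 (x, clamp 0) by rewrite Jh h10.
  exists (exist (ok k.+1) _ (conj cF' F'h)); exists J; split=> // u t t1 /=.
  by congr (J (_, _)); apply: unit_itv_inj; rewrite v1.
have [g cg gE] : exists2 g : Q -> Q, continuous g &
    forall x, g (set_val x) = h 0%N (x, clamp 0).
  apply: (@cube_extension R Q X (fun x => h 0%N (x, clamp 0))).
  - exact: cube_hausdorff.
  - exact: cube_compact.
  - exact: compact_closed cube_hausdorff cX.
  - apply: (@continuous_compose _ _ _ (fun x => (x, clamp 0)) (h 0%N)) => //.
    exact: continuous_pair (@continuous_idT _) (@continuous_const _ _ (clamp 0)).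
pose G := fix G k : T k := if k is k'.+1 then sval (step k' (G k'))
  else exist (ok 0%N) g (conj cg gE).
pose F k := sval (G k).
have Flink k : link k (F k) (F k.+1) by exact: (svalP (step k (G k))).
have Fc k : continuous (F k) := (svalP (G k)).1.
have Fh k x : F k (set_val x) = h k (x, clamp 0) := (svalP (G k)).2 x.
exists F; split=> //; split=> // [k|V /Bbasis[i BV]].
  by rewrite -[x0]/(set_val (point_of Xx0)) Fh hb.
have [K hK] : exists K, forall k, (K <= k)%N -> forall p, B i (h k p).
  by apply: hY => y Yy; apply: open_nbhs_nbhs; split; [exact: oB|exact: (BP i).2].
(* Beyond [K] all the homotopies on [X] lie in [B i], beyond [i] their extensions take
   care of [B i]. *)
pose K' := maxn K i; exists (F K' @^-1` B i).
  move=> x Xx; apply: open_nbhs_nbhs; split.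
    by apply: open_comp; [move=> u _; exact: Fc|exact: oB].
  by rewrite /= -[x]/(set_val (point_of Xx)) Fh; apply: hK; rewrite leq_max leqnn.
have FB k u : (K' <= k)%N -> B i (F K' u) -> B i (F k u).
  move=> + Bu; elim: k => [|k IHk]; first by rewrite leqn0 => /eqP <-.
  rewrite leq_eqVlt => /predU1P[<-//|]; rewrite ltnS => Kk.
  have [J [_ J0 J1 Jh JB]] := Flink k.
  rewrite -(J1 u (clamp 1))//; apply: JB; last exact: IHk.
    by apply: leq_trans Kk; rewrite leq_max leqnn orbT.
  by apply: hK; apply: leq_trans Kk; rewrite leq_max leqnn.
exists K' => // k /= Kk.
have [J [cJ J0 J1 Jh JB]] := Flink k.
exists (fun p => J (set_val p.1, p.2)).
split=> [|u t t0|u t t1|u t|u t ux0] /=; [|by rewrite J0|by rewrite J1| |].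
- apply: (@continuous_compose _ _ _ (fun p => (set_val p.1, p.2)) J) => //.
  apply: continuous_pair; last exact: continuous_sndT.
  exact: continuous_compose (@continuous_fstT _ _) (@continuous_set_val _ _).
- apply: BV; apply: JB; last by apply: FB => //; exact: (set_valP u).
    by apply: leq_trans Kk; rewrite leq_max leqnn orbT.
  by apply: hK; apply: leq_trans Kk; rewrite leq_max leqnn.
- by rewrite ux0 -[x0]/(set_val (point_of Xx0)) Jh; exact: hb.
Qed.

Lemma phomotopic_sym X x0 V y0 (f g : Q -> Q) :
  phomotopic_in X x0 V y0 f g -> phomotopic_in X x0 V y0 g f.
Proof.
move=> [H [cH H0 H1 HV Hb]]; exists (fun p => H (p.1, clamp (1 - val p.2))).
split=> [|u t t0|u t t1|u t|u t ux0] /=; [|by rewrite H1// /val t0 subr0 clampK// ler01 lexx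
  |by rewrite H0// /val t1 subrr clampK// ler01 lexx|exact: HV|exact: Hb].
apply: (@continuous_compose _ _ _ (fun p => (p.1, clamp (1 - val p.2))) H) => //.
apply: continuous_pair; first exact: continuous_fstT.
apply: (@continuous_compose _ _ _ (fun p : (X : Type) * I => 1 - val p.2) clamp).
  apply: continuous_subR; first exact: continuous_const.
  exact: (continuous_compose (@continuous_sndT _ _) continuous_val).
exact: continuous_clamp.
Qed.

(** A homotopy from [f K] to [g] on [X], for one large [K], extends to a neighborhood of
    [X]; the homotopies between the consecutive terms of [f] give the later terms. *)
Lemma fundamental_homotopic_const X x0 Y y0 (f : nat -> Q -> Q) (g : Q -> Q) :
  fundamental_sequence X x0 Y y0 f -> compact X -> X x0 -> continuous g ->
  (forall V, open V -> Y `<=` V ->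
    exists K, forall k, (K <= k)%N -> phomotopic_in X x0 V y0 (f k) g) ->
  fundamental_homotopic X x0 Y y0 f (fun=> g).
Proof.
move=> [cf _ ff] cX Xx0 cg fg V /set_nbhsP[C [oC YC CV]].
have nC : set_nbhs Y C by apply/set_nbhsP; exists C; split.
have [U nU [K1 _ UK]] := ff C nC.
have [K2 fgK] := fg C oC YC; pose K := maxn K1 K2.
have [U' nU' hU'] := phomotopic_neighborhood cX Xx0 oC (cf K) cg (fgK K (leq_maxr _ _)).
exists (U `&` U'); first by move=> x Xx; apply: filterI; [exact: nU|exact: nU'].
exists K => // k /= Kk; apply: (phomotopic_sub (@subset_refl _ (U `&` U')) CV).
elim: k Kk => [|k IHk].
  rewrite leqn0 => /eqP E; move: hU'; rewrite E.
  by apply: phomotopic_sub => //; exact: subIsetr.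
rewrite leq_eqVlt => /predU1P[<-|].
  by apply: phomotopic_sub hU' => //; exact: subIsetr.
rewrite ltnS => Kk; apply: phomotopic_trans (IHk Kk).
apply: phomotopic_sym; apply: (phomotopic_sub (@subIsetl _ U U') (@subset_refl _ C)).
by apply: UK; apply: leq_trans Kk; exact: leq_maxl.
Qed.

Lemma fundamental_sequence_cst X x0 Y y0 (g : Q -> Q) :
  continuous g -> g x0 = y0 -> (forall x, X x -> Y (g x)) ->
  fundamental_sequence X x0 Y y0 (fun=> g).
Proof.
move=> cg g0 XY; split=> // V /set_nbhsP[C [oC YC CV]].
exists (g @^-1` C).
  move=> x /XY/YC Cx; apply: open_nbhs_nbhs; split=> //.
  by apply: open_comp => // u _; exact: cg.
exists 0%N => // k _ /=; exists (fun p => g (set_val p.1)).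
split=> // [|u t|u t ->//]; last exact/CV/(set_valP u).
apply: continuous_compose cg.
exact: continuous_compose (@continuous_fstT _ _) (@continuous_set_val _ _).
Qed.

Lemma fundamental_sequence_precomp X x0 Y y0 Z z0 (f : nat -> Q -> Q) (g : Q -> Q) :
  fundamental_sequence X x0 Y y0 f -> continuous g -> g z0 = x0 ->
  (forall z, Z z -> X (g z)) ->
  fundamental_sequence Z z0 Y y0 (fun k => f k \o g).
Proof.
move=> [cf f0 ff] cg g0 ZX; split=> [k|k|V /ff[U nU UV]].
- exact: continuous_compose cg (cf k).
- by rewrite /= g0.
- exists (g @^-1` U); first by move=> z /ZX/nU; exact: cg.
  by apply: filterS UV => k; exact: phomotopic_precomp.
Qed.

Lemma fundamental_sequence_postcomp X x0 Y y0 Z z0 (f : nat -> Q -> Q) (g : Q -> Q) :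
  fundamental_sequence X x0 Y y0 f -> continuous g -> g y0 = z0 ->
  (forall y, Y y -> Z (g y)) ->
  fundamental_sequence X x0 Z z0 (fun k => g \o f k).
Proof.
move=> [cf f0 ff] cg g0 YZ; split=> [k|k|V nV].
- exact: continuous_compose (cf k) cg.
- by rewrite /= f0.
- have /ff[U nU UV] : set_nbhs Y (g @^-1` V) by move=> y /YZ/nV; exact: cg.
  exists U => //; apply: filterS UV => k; exact: phomotopic_postcomp.
Qed.

(** Here [Phi] and [M] are semiflows on [X] and [Y], and [G] maps [Y] to [X].  The map
    [H (_, t)] stands for [Phi (_, t)] followed by a map to [Y] that is only defined on the
    attractor; this is why its values merely approach [Y].  Going from [Y] to [X] and back
    is running [M] for the time [c + k]; going from [X] to [Y] and back is running [Phi]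
    for the time [c + t], up to a short segment of the cube.  Both are homotopic to the
    identity along the semiflows. *)
Lemma shape_shift_equivalence X x0 Y y0 (c : R)
    (H : (X : Type) * R -> Q) (Phi : (X : Type) * R -> Q)
    (G : Q -> Q) (M : (Y : Type) * R -> Q) :
  compact X -> compact Y -> X x0 -> Y y0 -> 
  continuous H -> continuous Phi -> continuous G -> continuous M ->
  (forall x t, set_val x = x0 -> H (x, t) = y0) ->
  (forall x t, set_val x = x0 -> Phi (x, t) = x0) ->
  G y0 = x0 ->
  (forall y t, set_val y = y0 -> M (y, t) = y0) ->
  (forall y, Y y -> X (G y)) ->
  (forall V, set_nbhs Y V -> exists T, forall x t, T <= t -> V (H (x, t))) ->
  (forall x t, X (Phi (x, t))) -> (forall x, Phi (x, 0) = set_val x) ->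
  (forall y t, Y (M (y, t))) -> (forall y, M (y, 0) = set_val y) ->
  (forall (k : nat) y x, set_val x = G (set_val y) ->
    M (y, c + k%:R) = H (x, k%:R)) ->
  (forall V, set_nbhs X V -> exists T, forall x t, T <= t -> forall s : I,
    V (fun n => clamp ((1 - val s) * coord n (G (H (x, t))) +
                       val s * coord n (Phi (x, c + t))))) ->
  fundamental_equivalent X x0 Y y0.
Proof.
move=> cX cY Xx0 Yy0 cH cPhi cG cM Hb Phib Gb Mb GX HY PhiX Phi0 MY M0 MH near.
pose h k (p : (X : Type) * I) := H (p.1, k%:R + val p.2).
have archi (T : R) : exists K : nat, T <= K%:R.
  by exists (Num.truncn `|T|).+1; apply: le_trans (ler_norm T) (ltW (truncnS_gt _)).
have v0 : set_val (clamp (0 : R)) = 0 by rewrite clampK// lexx ler01.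
have v1 : set_val (clamp (1 : R)) = 1 by rewrite clampK// ler01 lexx.
have [||||F [FF Fh]] := @fundamental_sequence_extension X x0 Y y0 h cX cY Xx0.
- move=> k; apply: (@continuous_compose _ _ _ (fun p => (p.1, k%:R + val p.2)) H) => //.
  apply: continuous_pair; first exact: continuous_fstT.
  apply: continuous_addR; first exact: continuous_const.
  exact: (continuous_compose (@continuous_sndT _ _) continuous_val).
- by move=> k x; rewrite /h /= /val v0 v1 addr0 natr1.
- by move=> k x t; exact: Hb.
- move=> V /HY[T HT]; have [K KT] := archi T.
  exists K => k Kk p; apply: HT; apply: le_trans KT _.
  have /andP[p0 _] := unit_itvP p.2.
  by apply: (@le_trans _ _ k%:R); [rewrite ler_nat|rewrite lerDl].
have {}Fh k x : F k (set_val x) = H (x, k%:R) by rewrite Fh /h /= /val v0 addr0.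
exists F, (fun=> G); split=> //.
- exact: fundamental_sequence_cst.
- apply: fundamental_homotopic_const => //.
  + exact: fundamental_sequence_postcomp FF _ _ _.
  + exact: continuous_idT.
  + move=> V oV XV; have [|T VT] := near V.
      by move=> x Xx; apply: open_nbhs_nbhs; split=> //; exact: XV.
    have [K KT] := archi T; exists K => k Kk.
    have {KT Kk}Tk : T <= k%:R by apply: le_trans KT _; rewrite ler_nat.
    (* The intermediate map [x |-> Phi (x, c + k)] of [X], extended to the cube by the identity. *)
    pose m (q : Q) : Q :=
      if pselect (X q) is left Xq then Phi (point_of Xq, c + k%:R) else q.
    have mE (x : X) : m (set_val x) = Phi (x, c + k%:R).
      rewrite /m; case: pselect => [Xx|]; last by case; exact: set_valP.
      by congr (Phi (_, _)); apply: val_inj.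
    have cat (L : (X : Type) * R -> Q) (t : R) : continuous L ->
        continuous (fun p : (X : Type) * I => L (p.1, t)).
      move=> cL; apply: (@continuous_compose _ _ _ (fun p => (p.1, t)) L) => //.
      apply: continuous_pair; first exact: continuous_fstT.
      exact: continuous_const.
    apply: (@phomotopic_trans _ _ _ _ _ m).
      exists (fun (p : (X : Type) * I) n => clamp
        ((1 - val p.2) * coord n (G (H (p.1, k%:R))) +
         val p.2 * coord n (Phi (p.1, c + k%:R)))).
      have cv : continuous (fun p : (X : Type) * I => val p.2).
        exact: continuous_compose (@continuous_sndT _ _) continuous_val.
      split=> [|x t t0|x t t1|x t|x t xx0] /=.
      * apply: continuous_clamp_cube => n; apply: continuous_addR; apply: continuous_mulR => //.
        - exact: continuous_subR (@continuous_const _ _ _) cv.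
        - apply: continuous_compose (@continuous_coordn n).
          exact: continuous_compose (cat H k%:R cH) cG.
        - exact: continuous_compose (cat Phi (c + k%:R) cPhi) (@continuous_coordn n).
      * apply: functional_extensionality_dep => n.
        by rewrite /val t0 subr0 mul1r mul0r addr0 Fh; exact: set_valK.
      * apply: functional_extensionality_dep => n.
        by rewrite /val t1 subrr mul1r mul0r add0r mE; exact: set_valK.
      * exact: VT.
      * apply: functional_extensionality_dep => n.
        by rewrite Hb// Phib// Gb -mulrDl subrK mul1r; exact: set_valK.
    by apply: (@phomotopicI (c + k%:R) 0 _ _ _ _ _ _ Phi) => // [x t t01]; exact/XV.
- apply: fundamental_homotopic_const => //.
  + exact: fundamental_sequence_precomp FF _ _ _.
  + exact: continuous_idT.
  + move=> V oV YV; exists 0%N => k _.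
    apply: (@phomotopicI (c + k%:R) 0 _ _ _ _ _ _ M) => // [y|x t t01]; last exact/YV.
    have XGy : X (G (set_val y)) by exact/GX/set_valP.
    by rewrite (MH k y (point_of XGy))// -Fh.
Qed.
End homotopy.

(** * Closed sets collapsed inside the cube *)

Section collapsing_maps.
Context {R : realType} {n : nat}.
Local Notation E := 'rV[R]_n.
Local Notation Q := (hilbert_cube R).

(** The distance to [A], truncated at [1]; the constant [1] when [A] is empty *)
Lemma closed_zero_set (A : set E) : closed A -> exists l : E -> R,
  [/\ continuous l, forall x, 0 <= l x <= 1 & forall x, l x = 0 <-> A x].
Proof.
move=> clA; have [->|/set0P[a0 Aa0]] := eqVneq A set0.
  exists (fun=> 1); split=> [|x|x]; first exact: continuous_const.
    by rewrite ler01 lexx.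
  by split=> // /eqP; rewrite oner_eq0.
have dfin x : edist_inf A x \is a fin_num.
  rewrite ge0_fin_numE ?edist_inf_ge0//.
  apply: (@le_lt_trans _ _ (edist (x, a0))).
    by apply: ereal_inf_lbound; exists a0.
  rewrite -ge0_fin_numE ?edist_ge0//; apply/edist_finP => /=.
  exists (`|x - a0| + 1); first by rewrite ltr_wpDl.
  by rewrite -ball_normE /ball_/= ltrDl.
pose d x := fine (edist_inf A x).
have cd : continuous d.
  move=> x; have /fine_cvg : edist_inf A y @[y --> x] --> (fine (edist_inf A x))%:E.
    by rewrite fineK//; exact: edist_inf_continuous.
  exact.
have d0 x : d x = 0 <-> A x.
  split=> [dx0|Ax]; last by rewrite /d edist_inf0.
  apply: clA => B /nbhs_ballP[e e0 eB].
  have : (edist_inf A x < e%:E)%E by rewrite -(fineK (dfin x)) -/(d x) dx0 lte_fin.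
  move=> /ereal_inf_lt[_ [a Aa <-]] /edist_lt_ball xa.
  by exists a; split=> //; exact: eB.
exists (fun x => Num.min (d x) 1); split=> [x|x|x].
- exact: (@continuous_min R E d (fun=> 1) x (cd x)
    (@continuous_const E R 1 x)).
- by rewrite le_min ge_min lexx ler01 orbT fine_ge0// edist_inf_ge0.
- rewrite -d0; split=> [|->]; last by rewrite min_l.
  by rewrite minEle; case: ifP => // _ /eqP; rewrite oner_eq0.
Qed.

Definition cube0 : Q := fun=> clamp 0.

(** The coordinates are [l] and the products [l * rho (x_i)], where [l] vanishes exactly on
    [A] and [rho] is a continuous injection of the line in [0, 1]: where [l] is not [0],
    they determine [x]. *)
Lemma collapsing_map (A : set E) : closed A -> exists q : E -> Q,
  [/\ continuous q, forall x, q x = cube0 <-> A x &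
      forall x y, ~ A x -> q x = q y -> x = y].
Proof.
move=> /closed_zero_set[l [cl l01 lA]].
pose rho (t : R) := (1 + atan t / (pi / 2)) / 2.
have pi2 : 0 < pi / 2 :> R by rewrite divr_gt0// pi_gt0.
have rho01 t : 0 <= rho t <= 1.
  have : -1 <= atan t / (pi / 2) <= 1.
    by rewrite ler_pdivlMr// ler_pdivrMr// mulN1r mul1r !ltW ?atan_gtNpi2 ?atan_ltpi2.
  by rewrite /rho; move: (atan t / _) => a /andP[? ?]; apply/andP; split; lra.
have rho_inj : injective rho.
  move=> s t st; rewrite -(atanK s) -(atanK t); congr (tan _).
  have : atan s / (pi / 2) = atan t / (pi / 2) by move: st; rewrite /rho; lra.
  by apply: mulIf; rewrite invr_eq0 gt_eqF.
have crho : continuous rho.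
  apply: continuous_mulR; last exact: continuous_const.
  apply: continuous_addR; first exact: continuous_const.
  apply: continuous_mulR; last exact: continuous_const.
  by move=> t; exact: continuous_atan.
pose g (o : option 'I_n) (x : E) : R := if o is Some i then l x * rho (x ord0 i) else 0.
pose f (k : nat) (x : E) : R := if k is j.+1 then g (insub j) x else l x.
have f01 k x : 0 <= f k x <= 1.
  case: k => [//|j] /=; case: (insub j : option 'I_n) => [i|] /=; last by rewrite lexx ler01.
  have /andP[l0 l1] := l01 x; have /andP[r0 r1] := rho01 (x ord0 i).
  by rewrite mulr_ge0//= mulr_ile1.
have cg o : continuous (g o).
  case: o => [i|]; last exact: (@continuous_const E R 0).
  apply: continuous_mulR => //; apply: continuous_compose crho.
  by move=> x; exact: coord_continuous.
have cf k : continuous (f k) by case: k => [|j]; [exact: cl|exact: cg].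
have qE x y : (fun k => clamp (f k x)) = (fun k => clamp (f k y)) -> forall k, f k x = f k y.
  by move=> xy k; rewrite -(clampK (f01 k x)) -(clampK (f01 k y)) (congr1 (@^~ k) xy).
exists (fun x k => clamp (f k x)); split=> [|x|x y nAx /qE xy].
- exact: continuous_clamp_cube.
- rewrite -lA; split=> [q0|lx0].
    have := congr1 (fun z : Q => set_val (z 0%N)) q0.
    by rewrite clampK// clampK// lexx ler01.
  apply: functional_extensionality_dep => -[|j] /=; first by rewrite lx0.
  by case: (insub j : option 'I_n) => [i|//] /=; rewrite lx0 mul0r.
- have lx : l x != 0 by apply/eqP => /lA.
  apply/rowP => i; apply: rho_inj; have := xy i.+1 => /=.
  rewrite insubT// => ?; rewrite (_ : Sub _ _ = i); last exact: val_inj.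
  by rewrite /g -(xy 0%N : l x = l y); apply: mulfI.
Qed.

End collapsing_maps.

(** * Gluings, collapses and cones as compacta of the cube *)

Section gluing.
Local Open Scope quotient_scope.
Context {T : topologicalType} (r : T -> T -> Prop).

Lemma glue_piP (x y : T) : glue_pi r x = glue_pi r y <->
  Relation_Operators.clos_refl_sym_trans T r x y.
Proof.
split=> [/eqmodP|xy]; first by move/asboolP.
by apply/eqmodP/asboolP.
Qed.

Lemma glue_pi_continuous : continuous (glue_pi r).
Proof. by apply/continuousP => A; exact. Qed.

Lemma glue_pi_surj (u : Defs.glue r) : exists x, glue_pi r x = u.
Proof. by exists (repr u); exact: reprK. Qed.

Lemma glue_lift (Z : topologicalType) (f : T -> Z) :
  continuous f -> (forall u v, r u v -> f u = f v) ->
  exists2 f' : Defs.glue r -> Z, continuous f' & forall x, f' (glue_pi r x) = f x.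
Proof.
move=> cf rf.
have rf' u v : Relation_Operators.clos_refl_sym_trans T r u v -> f u = f v.
  by elim=> [//|//|x y _ ->//|x y z _ -> _ ->].
have fE x : f (repr (glue_pi r x)) = f x.
  by apply: rf'; apply/glue_piP; rewrite /glue_pi reprK.
exists (fun u => f (repr u)) => //.
apply/continuousP => A oA; rewrite /open/= /quotient_open.
have -> : \pi_(Defs.glue r) @^-1` ((fun u => f (repr u)) @^-1` A) = f @^-1` A.
  by apply/funext => x; rewrite /preimage /mkset -[in RHS]fE.
by move/continuousP : cf; exact.
Qed.

Lemma glue_compact : compact [set: T] -> compact [set: Defs.glue r].
Proof.
move=> cT; have -> : [set: Defs.glue r] = glue_pi r @` [set: T].
  by apply/seteqP; split=> // u _; have [x <-] := glue_pi_surj u; exists x.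
apply: continuous_compact cT.
exact/continuous_subspaceT/glue_pi_continuous.
Qed.

(** A continuous map from a compact space to a Hausdorff space is closed. *)
Lemma compact_cube_embedding (R : realType) (X : topologicalType)
    (i : X -> hilbert_cube R) :
  compact [set: X] -> continuous i -> injective i -> cube_embedding i.
Proof.
move=> cX ci ii; split=> // A oA; exists (~` (i @` (~` A))).
  apply: closed_openC; apply: compact_closed; first exact: cube_hausdorff.
  apply: continuous_compact; first exact: continuous_subspaceT.
  by apply: (subclosed_compact _ cX) => //; exact: open_closedC.
apply/seteqP; split=> [x Ax [y nAy /ii yx]|x nAx]; first by apply: nAy; rewrite yx.
by apply: contrapT => nA; apply: nAx; exists x.
Qed.

Lemma glue_embedding (R : realType) (f : T -> hilbert_cube R) :
  compact [set: T] -> continuous f -> (forall u v, r u v -> f u = f v) ->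
  (forall u v, f u = f v -> glue_pi r u = glue_pi r v) ->
  exists2 i : Defs.glue r -> hilbert_cube R, cube_embedding i &
    forall x, i (glue_pi r x) = f x.
Proof.
move=> cT cf rf fr; have [i ci iE] := glue_lift cf rf.
exists i => //; apply: compact_cube_embedding => //; first exact: glue_compact.
move=> u v; have [x <-] := glue_pi_surj u; have [y <-] := glue_pi_surj v.
by rewrite !iE; exact: fr.
Qed.

End gluing.

Section topological_sum.
Context {X Y : topologicalType}.

Definition tsum_map (Z : Type) (f : X -> Z) (g : Y -> Z) (p : tsum X Y) : Z :=
  let: existT b x := p in
  (if b as b return tsum_fam X Y b -> Z then f else g) x.

Lemma tsum_map_continuous (Z : topologicalType) (f : X -> Z) (g : Y -> Z) :
  continuous f -> continuous g -> continuous (tsum_map f g).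
Proof.
by move=> cf cg [[] x] B nB; [exact: (cf x B nB)|exact: (cg x B nB)].
Qed.

Lemma tsum_compact : compact [set: X] -> compact [set: Y] -> compact [set: tsum X Y].
Proof.
by move=> cX cY; apply: sigT_compact => [|[]//]; exact: finite_finset.
Qed.

Lemma tsumP (p : tsum X Y) : (exists x, p = tinl Y x) \/ (exists y, p = tinr X y).
Proof. by case: p => -[] x; [left|right]; exists x. Qed.

End topological_sum.

Lemma one_point_compact : compact [set: one_point].
Proof.
have -> : [set: one_point] = [set (tt : one_point)] by apply/seteqP; split=> -[].
exact: compact_set1.
Qed.

Section collapse.
Context {R : realType} {X : topologicalType} (A : set X).
Local Notation Q := (hilbert_cube R).

Lemma collapse_pi_eq (a : X) : A a -> collapse_pi A a = collapse_base A.
Proof.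
by move=> Aa; apply/glue_piP/Relation_Operators.rst_step; exists a.
Qed.

Lemma collapse_embedding (q : X -> Q) (b : Q) :
  compact [set: X] -> continuous q -> (forall x, q x = b <-> A x) ->
  (forall x y, ~ A x -> q x = q y -> x = y) ->
  compact [set: collapse A] /\ exists i : collapse A -> Q, [/\ cube_embedding i,
    range i = range q `|` [set b], i (collapse_base A) = b &
    forall x, i (collapse_pi A x) = q x].
Proof.
move=> cX cq qA qi.
have cT : compact [set: tsum X one_point] := tsum_compact cX one_point_compact.
split; first exact: glue_compact.
pose f : tsum X one_point -> Q := tsum_map q (fun=> b).
have [|||i ei iE] := @glue_embedding _ (collapse_rel A) R f cT.
- by apply: tsum_map_continuous => //; exact: continuous_const.
- by move=> u v [a Aa [-> ->]] /=; exact/qA.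
- have fA (x : X) : f (tinl one_point x) = b -> collapse_pi A x = collapse_base A.
    by move=> /qA; exact: collapse_pi_eq.
  move=> u v; have [[x ->]|[[] ->]] := tsumP u; have [[y ->]|[[] ->]] := tsumP v => fuv //.
  + have [Ax|nAx] := pselect (A x).
      have Ay : A y by apply/qA; rewrite -[LHS]/(f (tinl one_point y)) -fuv; exact/qA.
      by rewrite -!/(collapse_pi A _) !collapse_pi_eq.
    by rewrite (qi x y nAx).
  + exact: (fA x).
  + by apply/esym/(fA y).
exists i; split=> //; [|by rewrite iE|by move=> x; rewrite iE].
apply/seteqP; split=> [_ [u _ <-]|z].
  have [p <-] := glue_pi_surj u; rewrite iE; have [[x ->]|[[] ->]] := tsumP p.
    by left; exists x.
  by right.
move=> [[x _ <-]|->].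
  by exists (collapse_pi A x) => //; rewrite iE.
by exists (collapse_base A) => //; rewrite iE.
Qed.

End collapse.

Section cone.
Context {R : realType} {W : topologicalType} (A : set W).
Local Notation Q := (hilbert_cube R).
Local Notation I := (unit_itv R).

(** The cone is embedded on its own first, by [collapse_embedding]; what remains is the
    gluing of two compacta of the cube along the base of the cone. *)
Lemma attach_cone_embedding (q : W -> Q) (c : (set_type A * I)%type -> Q) (b : Q) :
  compact [set: W] -> compact A -> continuous q -> continuous c ->
  injective q -> (forall w, q w <> b) ->
  (forall a t, set_val t = 0 -> c (a, t) = q (set_val a)) ->
  (forall a t, c (a, t) = b <-> set_val t = 1) ->
  (forall x y, set_val x.2 <> 1 -> c x = c y -> x = y) ->
  (forall w a t, q w = c (a, t) -> w = set_val a /\ set_val t = 0) ->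
  compact [set: attach_cone R W A] /\ exists i : attach_cone R W A -> Q,
    [/\ cube_embedding i, range i = range q `|` range c `|` [set b] &
        i (attach_cone_vertex R W A) = b].
Proof.
move=> cW cA cq cc qi qb c0 c1 ci qc.
have cAI : compact [set: (set_type A * I)%type].
  rewrite -setXTT; apply: compact_setX; first exact: compact_set_type.
  exact: unit_itv_compact.
have [|ck [ic [eic _ icb icE]]] :=
    @collapse_embedding R _ (cone_top R (set_type A)) c b cAI cc _ ci.
  by case=> a t; exact: c1.
have [icI icC _] := eic.
have cT : compact [set: tsum W (cone R (set_type A))] := tsum_compact cW ck.
split; first exact: glue_compact.
pose f : tsum W (cone R (set_type A)) -> Q := tsum_map q ic.
have coneP (k : cone R (set_type A)) : k = collapse_base _ \/
    exists a t, k = collapse_pi (cone_top R (set_type A)) (a, t).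
  have [p <-] := glue_pi_surj k; have [[[a t] ->]|[[] ->]] := tsumP p.
    by right; exists a, t.
  by left.
have glueE w k : q w = ic k ->
    glue_pi (@attach_cone_rel R W A) (tinl _ w) = glue_pi (@attach_cone_rel R W A) (tinr _ k).
  have [->|[a [t ->]]] := coneP k; first by rewrite icb => /qb.
  rewrite icE => /qc[-> t0].
  by apply/glue_piP/Relation_Operators.rst_step; exists a, t.
have [|||i ei iE] := @glue_embedding _ (@attach_cone_rel R W A) R f cT.
- exact: tsum_map_continuous.
- by move=> u v [a [t [t0 -> ->]]] /=; rewrite icE c0.
- move=> u v; have [[x ->]|[x ->]] := tsumP u; have [[y ->]|[y ->]] := tsumP v => /= fuv.
  + by rewrite (qi _ _ fuv).
  + exact: glueE.
  + by apply/esym/glueE.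
  + by rewrite (icI _ _ fuv).
exists i; split=> //; last by rewrite iE.
apply/seteqP; split=> [_ [u _ <-]|z].
  have [p <-] := glue_pi_surj u; rewrite iE; have [[x ->]|[k ->]] /= := tsumP p.
    by left; left; exists x.
  have [->|[a [t ->]]] := coneP k; first by right; exact: icb.
  by left; right; rewrite icE; exists (a, t).
move=> [[[x _ <-]|[[a t] _ <-]]|->].
- by exists (glue_pi (@attach_cone_rel R W A) (tinl _ x)) => //; rewrite iE.
- by exists (glue_pi (@attach_cone_rel R W A)
    (tinr _ (collapse_pi (cone_top R (set_type A)) (a, t)))) => //; rewrite iE /= icE.
- by exists (attach_cone_vertex R W A) => //; rewrite iE.
Qed.

End cone.

(** * Functions that descend to a collapsed compactum *)

Lemma continuous_within_near (T U : topologicalType) (A : set T) (f : T -> U) :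
  {within A, continuous f} <->
  forall x, A x -> forall O, nbhs (f x) O -> \forall y \near x, A y -> O (f y).
Proof.
by split=> [/subspace_continuousP cf x Ax O nO|cf];
  [exact: (cf x Ax O nO)|apply/subspace_continuousP => x Ax O; exact: cf].
Qed.

Lemma hausdorff_separation (T : topologicalType) (x y : T) :
  hausdorff_space T -> x <> y ->
  exists A B, [/\ nbhs x A, nbhs y B & forall z, A z -> B z -> False].
Proof.
rewrite open_hausdorff => hT /eqP/hT[[A B] /= [/set_mem Ax /set_mem By] [oA oB /eqP AB0]].
exists A, B; split; [exact: open_nbhs_nbhs|exact: open_nbhs_nbhs|].
by move=> z Az Bz; have : (A `&` B) z by []; rewrite AB0.
Qed.

Section descent.
Context {R : realType} {E : topologicalType} (N : set E).
Local Notation Q := (hilbert_cube R).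

Definition pointed_image (q : E -> Q) (b : Q) : set Q := q @` N `|` [set b].

Lemma pointed_image_compact (q : E -> Q) (b : Q) :
  compact N -> continuous q -> compact (pointed_image q b).
Proof.
move=> cN cq; apply: compactU; last exact: compact_set1.
by apply: continuous_compact cN; exact: continuous_subspaceT.
Qed.

(** A family on the compact set [N] that is constant along the fibres of [q] factors
    continuously through [q].  The image is taken together with the point [b], because
    the quotient by the empty set has a base point outside of the image of [N]. *)
Lemma descent (q : E -> Q) (b : Q) (Z : topologicalType) (u : E * R -> Z) (z : Z) :
  compact N -> continuous q -> {within N `*` [set: R], continuous u} ->
  (forall x y t, N x -> N y -> q x = q y -> u (x, t) = u (y, t)) ->
  (forall x t, N x -> q x = b -> u (x, t) = z) ->
  exists U : (pointed_image q b : Type) * R -> Z, [/\ continuous U,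
    forall x p t, N x -> set_val p = q x -> U (p, t) = u (x, t) &
    forall p t, set_val p = b -> U (p, t) = z].
Proof.
move=> cN cq /continuous_within_near cu uq ub.
pose U (pt : (pointed_image q b : Type) * R) : Z :=
  if pselect (exists x, N x /\ q x = set_val pt.1) is left e
  then u (projT1 (cid e), pt.2) else z.
have UE x p t : N x -> set_val p = q x -> U (p, t) = u (x, t).
  move=> Nx px; rewrite /U; case: pselect => /= [e|[]]; last by exists x.
  by case: (cid e) => y [Ny yp] /=; apply: uq => //; rewrite yp.
have Ub p t : set_val p = b -> U (p, t) = z.
  move=> pb; rewrite /U; case: pselect => //= e.
  by case: (cid e) => y [Ny yp] /=; apply: ub => //; rewrite yp.
exists U; split=> // -[p0 t0] O nO.
have cv : continuous (fun pt : (pointed_image q b : Type) * R => set_val pt.1).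
  exact: continuous_compose (@continuous_fstT _ _) (@continuous_set_val _ _).
(* By compactness, the fibres of [q] over points near [p0] lie near the fibre over [p0]. *)
have near_fibre : \forall pt \near (p0, t0), forall x, N x -> q x = set_val pt.1 -> O (u (x, pt.2)).
  have cov := (near_covering_withinP N).2 ((compact_near_coveringP N).1 cN)
    _ (nbhs (p0, t0)) (fun pt x => q x = set_val pt.1 -> O (u (x, pt.2))) _ _.
  apply: cov => x Nx; have [qx|qx] := pselect (q x = set_val p0).
    have nO' : nbhs (u (x, t0)) O by rewrite -(UE x p0 t0).
    have [[A B] /= [nA nB] AB] := cu (x, t0) (conj Nx Logic.I) O nO'.
    exists (A, [set pt | B pt.2]) => /=.
      by split=> //; exact: (cvg_snd (F := nbhs p0) (G := nbhs t0) nB).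
    by move=> -[x' [p t]] /= [Ax' Bt] Nx' _; apply: (AB (x', t)).
  have [A [B [nA nB AB]]] := hausdorff_separation cube_hausdorff qx.
  exists (q @^-1` A, [set pt | B (set_val pt.1)]) => /=.
    by split; [exact: cq|exact: (cv (p0, t0) B nB)].
  by move=> -[x' [p t]] /= [Ax' Bp] _ xp; exfalso; apply: AB Ax' _; rewrite xp.
have near_base : \forall pt \near (p0, t0), set_val pt.1 = b -> O z.
  have [p0b|p0b] := pselect (set_val p0 = b).
    by apply: filterE => pt _; rewrite -(Ub p0 t0)//; exact: nbhs_singleton.
  have [A [B [nA nB AB]]] := hausdorff_separation cube_hausdorff p0b.
  have nA' : \forall pt \near (p0, t0), A (set_val pt.1) by exact: (cv (p0, t0) A nA).
  apply: filterS nA' => pt Apt ptb.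
  exfalso; apply: AB Apt _; by rewrite ptb; exact: nbhs_singleton.
have : \forall pt \near (p0, t0), O (U pt); last by [].
apply: filterS2 near_fibre near_base => -[p t] /= hf hb.
have [[x Nx xp]|pb] := set_valP p.
  by rewrite (UE x)//; exact: hf.
by rewrite Ub//; exact: hb.
Qed.

End descent.

(** * Orbits stopped at a closed set *)

Section flow.
Context {R : realType} {n : nat}.
Local Notation E := 'rV[R]_n.
Variable phi : E * R -> E.
Hypothesis phi_flow : is_flow phi.
Implicit Types (x y : E) (s t : R) (K L N V : set E).

Lemma flow_continuous : continuous phi. Proof. by case: phi_flow. Qed.

Lemma flow0 x : phi (x, 0) = x. Proof. by case: phi_flow. Qed.

Lemma flowD x s t : phi (phi (x, s), t) = phi (x, s + t).
Proof. by case: phi_flow. Qed.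

Lemma flowK x s : phi (phi (x, s), - s) = x.
Proof. by rewrite flowD subrr flow0. Qed.

Lemma flow_continuous_l t : continuous (fun x => phi (x, t)).
Proof.
apply: (@continuous_compose _ _ _ (fun x => (x, t)) phi); last exact: flow_continuous.
exact: continuous_pair (@continuous_idT _) (@continuous_const _ _ t).
Qed.

Lemma flow_continuous_r x : continuous (fun t => phi (x, t)).
Proof.
apply: (@continuous_compose _ _ _ (fun t => (x, t)) phi); last exact: flow_continuous.
exact: continuous_pair (@continuous_const _ _ x) (@continuous_idT _).
Qed.

Lemma near_flow_l x t V : nbhs (phi (x, t)) V -> \forall y \near x, V (phi (y, t)).
Proof. exact: flow_continuous_l. Qed.

Lemma near_flow_r x t V : nbhs (phi (x, t)) V -> \forall s \near t, V (phi (x, s)).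
Proof. exact: flow_continuous_r. Qed.

Lemma near_flow_leave N x t : closed N -> ~ N (phi (x, t)) ->
  \forall y \near x, ~ N (phi (y, t)).
Proof.
move=> clN nN; apply: (@near_flow_l x t (~` N)).
by apply: open_nbhs_nbhs; split=> //; exact: closed_openC.
Qed.

Definition hits L x t := exists2 s, 0 <= s <= t & L (phi (x, s)).

Lemma hits_le L x s t : s <= t -> hits L x s -> hits L x t.
Proof. by move=> st [r /andP[r0 rs] Lr]; exists r => //; rewrite r0 (le_trans rs). Qed.

Lemma hitsD L x s t : 0 <= s -> 0 <= t ->
  hits L x (s + t) <-> hits L x s \/ hits L (phi (x, s)) t.
Proof.
move=> s0 t0; split=> [[r /andP[r0 rst] Lr]|[[r /andP[r0 rs] Lr]|[r /andP[r0 rt] Lr]]].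
- have [rs|sr] := leP r s; first by left; exists r; rewrite ?r0.
  right; exists (r - s); last by rewrite flowD addrC subrK.
  by rewrite subr_ge0 ltW//= lerBlDl.
- by exists r => //; rewrite r0 (le_trans rs)// lerDl.
- by exists (s + r); [rewrite addr_ge0//= lerD2l|rewrite -flowD].
Qed.

(** When [u] sends [L] to [b], this is the composite of [u] with the semiflow on [N / L],
    where points stop when they meet [L].  Negative times count as [0], so that the
    function is defined on the whole line. *)
Definition run (Z : Type) L (u : E -> Z) (b : Z) (p : E * R) : Z :=
  if pselect (hits L p.1 (Num.max p.2 0)) then b else u (phi (p.1, Num.max p.2 0)).

Lemma run_hits (Z : Type) L (u : E -> Z) b x t :
  0 <= t -> hits L x t -> run L u b (x, t) = b.
Proof. by move=> t0 h; rewrite /run /= max_l//; case: pselect. Qed.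

Lemma run_free (Z : Type) L (u : E -> Z) b x t :
  0 <= t -> ~ hits L x t -> run L u b (x, t) = u (phi (x, t)).
Proof. by move=> t0 h; rewrite /run /= max_l//; case: pselect. Qed.

Lemma run_max (Z : Type) L (u : E -> Z) b x t :
  run L u b (x, t) = run L u b (x, Num.max t 0).
Proof. by rewrite /run /= -maxA maxxx. Qed.

Lemma run0 (Z : Type) L (u : E -> Z) b x :
  (forall y, L y -> u y = b) -> run L u b (x, 0) = u x.
Proof.
move=> uL; have [h|h] := pselect (hits L x 0); last by rewrite run_free// flow0.
rewrite run_hits//; case: h => s; rewrite -eq_le => /eqP <-.
by rewrite flow0 => /uL.
Qed.

Lemma run_start (Z : Type) L (u : E -> Z) b x t : L x -> run L u b (x, t) = b.
Proof.
move=> Lx; rewrite run_max run_hits ?le_max ?lexx ?orbT//.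
by exists 0; rewrite ?flow0 ?le_max ?lexx ?orbT.
Qed.

Lemma runD (Z : Type) L (u : E -> Z) b x s t : 0 <= s -> 0 <= t -> ~ hits L x s ->
  run L u b (x, s + t) = run L u b (phi (x, s), t).
Proof.
move=> s0 t0 nh; have [h|h] := pselect (hits L (phi (x, s)) t).
  by rewrite !run_hits// ?addr_ge0//; apply/hitsD => //; right.
rewrite !run_free ?addr_ge0 ?flowD//.
by move=> /hitsD-/(_ s0 t0)[].
Qed.

Lemma orbit_in_maximal K N x : isolating_neighborhood phi K N ->
  (forall t, N (phi (x, t))) -> K x.
Proof.
move=> [_ _ _ maxK] xN; apply: (maxK [set y | exists t, y = phi (x, t)]).
- rewrite /invariant_set /flow_image; apply/seteqP; split=> [_ [[z t] /= [[s zE] _] <-]|_ [t ->]].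
    by exists (s + t); rewrite zE flowD.
  by exists (phi (x, t), 0); [split=> //; exists t|rewrite flow0].
- by move=> _ [t ->].
- by exists 0; rewrite flow0.
Qed.

Lemma invariantP K x t : invariant_set phi K -> K x -> K (phi (x, t)).
Proof. by move=> invK Kx; rewrite -invK; exists (x, t). Qed.

Lemma invariant_iff K x t : invariant_set phi K -> K (phi (x, t)) <-> K x.
Proof.
move=> invK; split=> [|]; last exact: invariantP.
by move/(invariantP (- t) invK); rewrite flowK.
Qed.

(** * Isolating blocks *)

Section block.
Variables K N L L' : set E.
Hypothesis B : isolating_block phi K N L L'.

Let clN : closed N.
Proof. exact: compact_closed (@norm_hausdorff _ _) (block_compact B). Qed.

Let clL : closed L.
Proof. exact: compact_closed (@norm_hausdorff _ _) (block_exit_compact B). Qed.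

Let bdE : boundary N = N `\` N°.
Proof. by rewrite /boundary -(closure_id N).1. Qed.

Lemma exit_sub x : L x -> N x /\ ~ N° x.
Proof. by move=> Lx; have : boundary N x; [rewrite (block_boundary B); left|rewrite bdE]. Qed.

Lemma isolated_interior : K `<=` N°.
Proof. by case: (block_isolating B). Qed.

Lemma isolated_invariant : invariant_set phi K.
Proof. by case: (block_isolating B). Qed.

Lemma isolated_sub : K `<=` N.
Proof. by case: (block_isolating B). Qed.

Lemma exit_leaves x e : L x -> 0 < e -> exists2 t, 0 < t < e & ~ N (phi (x, t)).
Proof.
move=> Lx e0; have [d d0 hd] := block_exit B Lx.
exists (Num.min d e / 2).
  by rewrite divr_gt0 ?lt_min ?d0//= ltr_pdivrMr// gt_min ltr_pMr// ltr1n orbT.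
apply: hd; exists (x, Num.min d e / 2) => //; split=> //=.
rewrite in_itv/= divr_gt0 ?lt_min ?d0//= ltr_pdivrMr//.
by rewrite gt_min ltr_pMr// ltr1n.
Qed.

Lemma last_time_in x a b : a <= b -> N (phi (x, a)) -> ~ N (phi (x, b)) ->
  exists r, [/\ a <= r < b, N (phi (x, r)), ~ N° (phi (x, r)) &
    forall s, r < s <= b -> ~ N (phi (x, s))].
Proof.
move=> ab Na nNb.
pose A : set R := `[a, b]%classic `&` [set r | N (phi (x, r))].
have AE r : A r <-> a <= r <= b /\ N (phi (x, r)) by rewrite /A /= in_itv.
have Aa : A a by apply/AE; split; rewrite ?lexx ?ab.
have ubA : has_ubound A by exists b => r /AE[/andP[]].
have clA : closed A.
  apply: closedI; first exact: interval_closed.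
  by apply: closed_comp clN => r _; exact: flow_continuous_r.
have [/andP[ar rb] Nr] : a <= sup A <= b /\ N (phi (x, sup A)).
  by apply/AE/clA; apply: closure_sup => //; exists a.
have {}rb : sup A < b.
  by rewrite lt_neqAle rb andbT; apply/eqP => E; apply: nNb; rewrite -E.
have later s : sup A < s <= b -> ~ N (phi (x, s)).
  move=> /andP[As sb] NA; have : s <= sup A.
    by apply: ub_le_sup => //; apply/AE; split=> //; rewrite sb (le_trans ar)// ltW.
  by rewrite leNgt As.
exists (sup A); split=> //; first by rewrite ar rb.
move=> /near_flow_r[e /= e0 eN].
apply: (later (sup A + Num.min (e / 2) (b - sup A))).
  rewrite ltrDl lt_min divr_gt0//= subr_gt0 rb/=.
  by rewrite -lerBrDl ge_min lexx orbT.
apply: eN; rewrite /ball_/= opprD addNKr normrN ger0_norm.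
  by rewrite gt_min ltr_pdivrMr// ltr_pMr// ltr1n.
by rewrite le_min divr_ge0 ?ltW//= subr_gt0.
Qed.

(** At the last time in [N] the orbit is on the boundary; outside of the exit set, it would
    enter the interior just after. *)
Lemma free_stays x t : N x -> ~ hits L x t ->
  forall s, 0 <= s <= t -> N (phi (x, s)).
Proof.
move=> Nx nh s /andP[s0 st]; apply: contrapT => nNs.
have [|r [/andP[r0 rs] Nr nint later]] := last_time_in s0 _ nNs; first by rewrite flow0.
have nL : ~ L (phi (x, r)).
  by move=> Lr; apply: nh; exists r => //; rewrite r0/= (le_trans (ltW rs)).
have [|d d0 hd] := @block_not_exit _ _ _ _ _ _ _ B (phi (x, r)).
  by split=> //; rewrite bdE.
have m0 : 0 < Num.min d (s - r) by rewrite lt_min d0 subr_gt0.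
apply: (later (r + Num.min d (s - r))).
  by rewrite ltrDl m0 -lerBrDl ge_min lexx orbT.
apply: interior_subset; apply: hd; exists (phi (x, r), Num.min d (s - r)).
  by split=> //=; rewrite in_itv/= m0 ge_min lexx.
by rewrite /= flowD.
Qed.

(** If the orbit meets [L] before the final time, it has then left [N], and nearby orbits
    have left [N] as well, hence met [L].  If it meets [L] at the final time only, then [u]
    is close to [b] at the end of nearby orbits, stopped or not. *)
Lemma run_continuous (Z : topologicalType) (u : E -> Z) b :
  continuous u -> (forall y, L y -> u y = b) ->
  {within N `*` [set: R], continuous (run L u b)}.
Proof.
move=> cu uL; apply/continuous_within_near => -[x0 t0] [Nx0 _] O nO.
pose t1 := Num.max t0 0; have t10 : 0 <= t1 by rewrite le_max lexx orbT.
have cmax : continuous (fun p : E * R => Num.max p.2 0).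
  move=> p; exact: (@continuous_max R (E * R)%type snd (fun=> 0) p
    (@continuous_sndT E R p) (@continuous_const (E * R)%type R 0 p)).
have near_end V : nbhs (phi (x0, t1)) V ->
    \forall p \near (x0, t0), V (phi (p.1, Num.max p.2 0)).
  move=> nV.
  have c : continuous (fun p : E * R => phi (p.1, Num.max p.2 0)).
    apply: (@continuous_compose _ _ _ (fun p : E * R => (p.1, Num.max p.2 0)) phi).
      by apply: continuous_pair => //; exact: continuous_fstT.
    exact: flow_continuous.
  exact: (c (x0, t0) V nV).
have near_uend : nbhs (u (phi (x0, t1))) O ->
    \forall p \near (x0, t0), O (u (phi (p.1, Num.max p.2 0))).
  by move=> /cu/near_end.
have near_fst' V : nbhs x0 V -> \forall p \near (x0, t0), V p.1.
  by move=> nV; exact: (@continuous_fstT E R (x0, t0) V nV).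
have near_max (V : set R) : nbhs t1 V -> \forall p \near (x0, t0), V (Num.max p.2 0).
  by move=> nV; exact: (cmax (x0, t0) V nV).
have [h|nh] := pselect (hits L x0 t1).
  have rb : run L u b (x0, t0) = b by rewrite run_max run_hits.
  rewrite rb in nO; have Ob := nbhs_singleton nO.
  case: h => s /andP[s0 st] Ls; have [st1|ts] := ltP s t1.
    have [r /andP[r0 rt] nNr] : exists2 r, 0 < r < t1 - s & ~ N (phi (phi (x0, s), r)).
      by apply: exit_leaves => //; rewrite subr_gt0.
    have srt : s + r < t1 by rewrite -ltrBrDl.
    rewrite flowD in nNr.
    have n1 := near_fst' _ (near_flow_leave clN nNr).
    have n2 := near_max _ (lt_nbhsr srt).
    apply: filterS2 n1 n2 => -[x t] /= nNx tx [Nx _].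
    rewrite run_max run_hits ?le_max ?lexx ?orbT//.
    apply: contrapT => nh; apply: nNx; apply: (free_stays Nx nh).
    by rewrite addr_ge0// ltW.
  have E1 : s = t1 by apply: le_anti; rewrite st ts.
  have : nbhs (u (phi (x0, t1))) O by rewrite -E1 uL.
  move=> /near_uend; apply: filterS => -[x t] /= Oxt _.
  by rewrite /run /=; case: pselect.
have ru : run L u b (x0, t0) = u (phi (x0, t1)) by rewrite run_max run_free.
have n1 : \forall p \near (x0, t0), forall s, `[0, t1 + 1]%classic s ->
    s <= Num.max p.2 0 -> ~ L (phi (p.1, s)).
  apply: ((compact_near_coveringP _).1 (@segment_compact R 0 (t1 + 1)) _
    (nbhs (x0, t0)) (fun p s => s <= Num.max p.2 0 -> ~ L (phi (p.1, s)))).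
  move=> s; rewrite /= in_itv/= => /andP[s0 _]; have [st|ts] := leP s t1.
    have nL : ~ L (phi (x0, s)) by move=> Ls; apply: nh; exists s => //; rewrite s0.
    have nLs : nbhs (phi (x0, s)) (~` L).
      by apply: open_nbhs_nbhs; split=> //; exact: closed_openC.
    have [[A C] /= [nA nC] AC] := @flow_continuous (x0, s) _ nLs.
    exists (C, [set p | A p.1]) => /=; first by split=> //; exact: near_fst'.
    by move=> -[s' [x t]] /= [Cs' Ax] _; exact: (AC (x, s')).
  pose m := (t1 + s) / 2.
  have t1m : t1 < m by rewrite /m; lra.
  have ms : m < s by rewrite /m; lra.
  exists ([set s' | m < s'], [set p | Num.max p.2 0 < m]) => /=.
    by split; [exact: lt_nbhsr|exact: near_max _ (lt_nbhsl t1m)].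
  move=> -[s' [x t]] /= [ms' tm] s't.
  by move: (lt_trans ms' (le_lt_trans s't tm)); rewrite ltxx.
have n2 := near_uend _; rewrite -ru in n2.
have n3 : \forall p \near (x0, t0), Num.max p.2 0 < t1 + 1.
  by apply: (near_max _ (lt_nbhsl (_ : t1 < t1 + 1))); rewrite ltrDl.
apply: filterS3 n1 (n2 nO) n3 => -[x t] /= nLx Oxt tt1 _.
rewrite /run /=; case: pselect => //= -[s /andP[s0 st] Ls].
by exfalso; apply: nLx Ls => //=; rewrite in_itv/= s0 (le_trans st)// ltW.
Qed.

Definition asymptotic : set E := [set x | forall t, t <= 0 -> N (phi (x, t))].

Lemma asymptotic_sub x : asymptotic x -> N x.
Proof. by move=> /(_ 0 (lexx 0)); rewrite flow0. Qed.

Lemma asymptotic_closed : closed asymptotic.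
Proof.
move=> x clx t t0; apply: clN => V /near_flow_l nV.
by have [y [/(_ t t0) Ny Vy]] := clx _ nV; exists (phi (y, t)).
Qed.

Lemma isolated_asymptotic x : K x -> asymptotic x.
Proof. by move=> Kx t _; apply: isolated_sub; exact: invariantP isolated_invariant Kx. Qed.

Lemma asymptotic_back x t : t <= 0 -> asymptotic x -> asymptotic (phi (x, t)).
Proof. by move=> t0 Ax s s0; rewrite flowD; apply: Ax; rewrite -oppr_ge0 opprD addr_ge0// oppr_ge0. Qed.

Lemma asymptotic_free x t : 0 <= t -> asymptotic x -> ~ hits L x t ->
  asymptotic (phi (x, t)).
Proof.
move=> t0 Ax nh s s0; rewrite flowD; have [ts|ts] := leP (t + s) 0; first exact: Ax.
by apply: (free_stays (asymptotic_sub Ax) nh); rewrite ltW//= gerDl.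
Qed.

(** An orbit leaves [N] immediately after each meeting with [L]. *)
Lemma asymptotic_hits x s t : asymptotic (phi (x, t)) -> L (phi (x, s)) -> t <= s.
Proof.
move=> At Ls; rewrite leNgt; apply/negP => st.
have ts : 0 < t - s by rewrite subr_gt0.
have [r /andP[r0 rt]] := exit_leaves Ls ts; rewrite flowD => -[].
have := At (s + r - t); rewrite flowD (_ : t + (s + r - t) = s + r); [apply|lra].
by rewrite subr_le0 -lerBrDl ltW.
Qed.

Lemma asymptotic_leaves x : asymptotic x -> ~ K x -> exists2 t, 0 <= t & hits L x t.
Proof.
move=> Ax nK; apply: contrapT => nh; apply: nK.
apply: (orbit_in_maximal (block_isolating B)) => t.
have [t0|t0] := leP t 0; first exact: Ax.
apply: (free_stays (t := t) (asymptotic_sub Ax)); last by rewrite lexx ltW.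
by move=> h; apply: nh; exists t => //; exact: ltW.
Qed.

(** A point of [N] that is not asymptotic is out of [N] at some past time, and so are its
    neighbors; by compactness of [N], one bound on these times works for all the points
    where [P] fails. *)
Lemma asymptotic_attraction (P : E -> Prop) :
  (forall y, asymptotic y -> \forall y' \near y, N y' -> P y') ->
  exists T, 0 <= T /\
    forall x t, N x -> T <= t -> ~ hits L x t -> P (phi (x, t)).
Proof.
move=> nP.
have [T [_ HT]] : \forall T \near +oo, N `<=` (fun y =>
    (forall s, - T <= s <= 0 -> N (phi (y, s))) -> P y).
  apply: ((near_covering_withinP N).2 ((compact_near_coveringP N).1 (block_compact B)) _
    (pinfty_nbhs R) (fun T y => (forall s, - T <= s <= 0 -> N (phi (y, s))) -> P y)).
  move=> y Ny; have [Ay|nAy] := pselect (asymptotic y).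
    exists ([set y' | N y' -> P y'], setT) => /=; last by move=> -[y' T] [/= Py' _] Ny' _; exact: Py'.
    by split; [exact: nP|exact: filterT].
  have [s s0 nNs] : exists2 s, s <= 0 & ~ N (phi (y, s)).
    apply: contrapT => nex; apply: nAy => s s0; apply: contrapT => nNs; apply: nex.
    by exists s.
  exists ([set y' | ~ N (phi (y', s))], [set T | - s < T]) => /=.
    by split; [exact: near_flow_leave|exists (- s); split=> //; rewrite num_real].
  move=> -[y' T] /= [nN' sT] _ hN; exfalso; apply: nN'; apply: hN.
  by rewrite s0 lerNl ltW.
exists (Num.max 0 (T + 1)); split=> [|x t Nx Tt nh]; first by rewrite le_max lexx.
have [t0 Tt'] : 0 <= t /\ T + 1 <= t by move: Tt; rewrite ge_max => /andP.
have := HT t; apply; first by rewrite (lt_le_trans _ Tt')// ltrDl.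
  by apply: (free_stays Nx nh); rewrite t0 lexx.
move=> s /andP[ts s0]; rewrite flowD; apply: (free_stays Nx nh).
by rewrite -lerBlDl sub0r ts gerDl.
Qed.

Lemma omega_starP (X : set E) y : omega_star phi X y <->
  forall t, t <= 0 -> closure [set z | exists x s, [/\ X x, s <= t & z = phi (x, s)]] y.
Proof.
have E1 t : flow_image phi X `]-oo, t] =
    [set z | exists x s, [/\ X x, s <= t & z = phi (x, s)]].
  apply/seteqP; split=> [z [[x s] [/= Xx st] zE]|_ [x [s [Xx st ->]]]].
    by move: st; rewrite in_itv/= => st; exists x, s.
  by exists (x, s) => //; split=> //=; rewrite in_itv.
by split=> [h t t0|h t t0]; [rewrite -E1; exact: h|rewrite E1; exact: h].
Qed.

Lemma omega_star_flow x t : omega_star phi [set x] `<=` omega_star phi [set phi (x, t)].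
Proof.
move=> y /omega_starP hy; apply/omega_starP => s s0.
apply: closure_subset (hy (Num.min 0 (s + t)) _); last by rewrite ge_min lexx.
move=> _ [_ [r [-> rs ->]]]; exists (phi (x, t)), (r - t); split=> //.
  by rewrite lerBlDr (le_trans rs)// ge_min lexx orbT.
by rewrite flowD addrC subrK.
Qed.

Lemma omega_star_invariant x : invariant_set phi (omega_star phi [set x]).
Proof.
have M t y : omega_star phi [set x] y -> omega_star phi [set x] (phi (y, t)).
  move=> /omega_starP hy; apply/omega_starP => s s0 V /near_flow_l nV.
  have [|z [[_ [r [-> rs ->]]] Vz]] := hy (Num.min 0 (s - t)) _ _ nV.
    by rewrite ge_min lexx.
  exists (phi (x, r + t)); split; last by rewrite -flowD.
  exists x, (r + t); split=> //.
  by rewrite -lerBrDr (le_trans rs)// ge_min lexx orbT.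
apply/seteqP; split=> [_ [[y t] [/= My _] <-]|y My]; first exact: M.
by exists (y, 0) => //; rewrite flow0.
Qed.

(** The limit set in negative time is nonempty since the past is in the compact set [N]; it
    is an invariant subset of [N], so it lies in [K]. *)
Lemma asymptotic_unstable x : asymptotic x -> unstable_manifold phi K x.
Proof.
move=> Ax; split.
  have [|y [_ yc]] := block_compact B (F := phi (x, s) @[s --> -oo]) _ _.
    by exists 0; split=> // s s0; apply: Ax; exact: ltW.
  exists y; apply/omega_starP => t t0.
  rewrite clusterE in yc; apply: yc.
  by exists t; split; [exact: num_real|move=> s st; exists x, s; split=> //; exact: ltW].
case: (block_isolating B) => _ _ _ maxK; apply: maxK; first exact: omega_star_invariant.
move=> y /omega_starP/(_ 0 (lexx 0)) hy; apply: clN; apply: closure_subset hy.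
by move=> _ [_ [s [-> s0 ->]]]; exact: Ax.
Qed.

Lemma unstable_flow x t : unstable_manifold phi K x -> unstable_manifold phi K (phi (x, t)).
Proof.
have E1 : omega_star phi [set phi (x, t)] = omega_star phi [set x].
  apply/seteqP; split; last exact: omega_star_flow.
  by have := @omega_star_flow (phi (x, t)) (- t); rewrite flowK.
by rewrite /unstable_manifold /= E1.
Qed.

(** Otherwise, arbitrarily far in the past, some orbit starting in [S] is out of [N].  As it
    comes near [K] still earlier, it crosses the boundary of [N].  The crossing points
    accumulate at a point of the limit set of [S] on the boundary of [N], but [K] is in
    the interior. *)
Lemma section_enters (S : set E) : S `<=` unstable_manifold phi K ->
  omega_star phi S `<=` K ->
  exists T, 0 <= T /\ forall x t, S x -> t <= - T -> N (phi (x, t)).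
Proof.
move=> SW SK; apply: contrapT => nT.
pose A T : set E := [set z | boundary N z /\
  exists x s, [/\ S x, s <= - T & z = phi (x, s)]].
have A0 T : 0 <= T -> A T !=set0.
  move=> T0; have [x [t [Sx tT nN]]] : exists x t, [/\ S x, t <= - T & ~ N (phi (x, t))].
    apply: contrapT => nex; apply: nT; exists T; split=> // x t Sx tT.
    by apply: contrapT => nN; apply: nex; exists x, t.
  have [[k hk] sK] := SW x Sx; have Kk := sK k hk.
  have t0 : t <= 0 by rewrite (le_trans tT)// oppr_le0.
  have nk : nbhs k N by rewrite -/(N° k); exact: isolated_interior.
  have [z [[_ [r [-> rt ->]]] Nr]] := (omega_starP _ _).1 hk t t0 _ nk.
  have [a [/andP[ra at_] Na nia _]] := last_time_in rt Nr nN.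
  exists (phi (x, a)); split; first by rewrite bdE.
  by exists x, a; split=> //; rewrite (le_trans (ltW at_)).
pose F := filter_from [set T : R | 0 <= T] A.
have FF : ProperFilter F.
  apply: filter_from_proper; last by move=> T; exact: A0.
  apply: filter_from_filter; first by exists 0; rewrite /= lexx.
  move=> S1 S2 /= S10 S20; exists (Num.max S1 S2); first by rewrite /= le_max S10.
  move=> z [bz [x [s [Sx sT zE]]]].
  have hA T : T <= Num.max S1 S2 -> A T z.
    by move=> TS; split=> //; exists x, s; split=> //; rewrite (le_trans sT)// lerN2.
  by split; apply: hA; rewrite le_max lexx ?orbT.
have cb : compact (boundary N).
  apply: (subclosed_compact _ (block_compact B)); last by rewrite bdE => z [].
  by rewrite bdE setDE; apply: closedI => //; exact/open_closedC/open_interior.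
have [|z [bz zc]] := cb F FF; first by exists 0 => //= z [].
have Kz : K z.
  apply: SK; apply/omega_starP => t t0; rewrite clusterE in zc.
  apply: closure_subset (zc (A (- t)) _); first by move=> y [_]; rewrite opprK.
  by exists (- t) => //=; rewrite oppr_ge0.
by move: bz; rewrite bdE => -[_]; apply; exact: isolated_interior.
Qed.

End block.

End flow.

(** * Sections of the asymptotic set of a block *)

Section core.
Context {R : realType} {n : nat}.
Local Notation E := 'rV[R]_n.
Local Notation Q := (hilbert_cube R).
Variables (phi : E * R -> E) (K N L L' S : set E).
Hypothesis phi_flow : is_flow phi.
Hypothesis B : isolating_block phi K N L L'.
Local Notation A := (asymptotic phi N).
Hypothesis S_compact : compact S.
Hypothesis S_asymptotic : S `<=` A.
Hypothesis S_isolated : forall x, S x -> ~ K x.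
Hypothesis S_meets : forall x, A x -> ~ K x -> exists s r, S s /\ x = phi (s, r).
Hypothesis S_once : forall s s' r, S s -> S s' -> s' = phi (s, r) -> s = s'.

Let cN : compact N. Proof. exact: block_compact B. Qed.

Let clN : closed N. Proof. exact: compact_closed (@norm_hausdorff _ _) cN. Qed.

Let clL : closed L.
Proof. exact: compact_closed (@norm_hausdorff _ _) (block_exit_compact B). Qed.

Let invK : invariant_set phi K. Proof. exact: isolated_invariant B. Qed.

(** A point of the section that returned to it would be periodic, hence in [A] at
    arbitrarily late times; but it leaves [N]. *)
Lemma section_return_time s r : S s -> S (phi (s, r)) -> r = 0.
Proof.
move=> Ss Sr; have sr : phi (s, r) = s by rewrite -(S_once Ss Sr erefl).
have [t t0 [u /andP[u0 _] Lu]] := asymptotic_leaves phi_flow B (S_asymptotic Ss) (S_isolated Ss).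
(* Multiples of a positive period would be times in [A] after the orbit met [L]. *)
have no_period p : phi (s, p) = s -> p <= 0.
  move=> sp; rewrite leNgt; apply/negP => p0.
  have spk k : phi (s, k%:R * p) = s.
    elim: k => [|k IHk]; first by rewrite mul0r flow0.
    by rewrite -natr1 mulrDl mul1r -flowD// IHk.
  have h k : k%:R * p <= u.
    by apply: (asymptotic_hits phi_flow B _ Lu); rewrite spk; exact: S_asymptotic.
  have := h (Num.truncn (u / p)).+1; rewrite leNgt => /negP; apply.
  by rewrite -ltr_pdivrMr// truncnS_gt.
apply: le_anti; rewrite no_period//= -oppr_le0 no_period//.
by rewrite -{1}sr flowK.
Qed.

Lemma section_exit_bound : exists2 c, 0 <= c & forall s, S s -> hits phi L s c.
Proof.
have [c [_ hc]] : \forall c \near +oo, S `<=` (fun s => hits phi L s c).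
  apply: ((near_covering_withinP S).2 ((compact_near_coveringP S).1 S_compact) _
    (pinfty_nbhs R) (fun c s => hits phi L s c)) => s Ss.
  have [t t0 [u /andP[u0 _] Lu]] :=
    asymptotic_leaves phi_flow B (S_asymptotic Ss) (S_isolated Ss).
  have [r /andP[r0 _]] := exit_leaves B Lu (@ltr01 R); rewrite flowD// => nN.
  exists ([set s' | ~ N (phi (s', u + r))], [set c | u + r < c]) => /=.
    by split; [exact: (near_flow_leave phi_flow clN nN)|exists (u + r); split=> //; exact: num_real].
  move=> -[s' c] /= [nN' urc] Ss'; apply: contrapT => nh; apply: nN'.
  apply: (free_stays phi_flow B (asymptotic_sub phi_flow (S_asymptotic Ss')) nh).
  by apply/andP; split; lra.
exists (Num.max 0 (c + 1)) => [|s Ss]; first by rewrite le_max lexx.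
by apply: hc => //; rewrite lt_max ltrDl ltr01 orbT.
Qed.

Definition section_past : set E :=
  [set x | K x \/ exists s r, [/\ S s, r <= 0 & x = phi (s, r)]].

Lemma section_past_asymptotic : section_past `<=` A.
Proof.
move=> x [Kx|[s [r [Ss r0 ->]]]]; first exact: (isolated_asymptotic B).
by apply: asymptotic_back => //; exact: S_asymptotic.
Qed.

Lemma section_sub_past : S `<=` section_past.
Proof. by move=> s Ss; right; exists s, 0; rewrite flow0. Qed.

Let segment_image a b : closed (phi @` (S `*` `[a, b]%classic)).
Proof.
apply: compact_closed; first exact: norm_hausdorff.
apply: continuous_compact; first exact/continuous_subspaceT/flow_continuous.
by apply: compact_setX => //; exact: segment_compact.
Qed.

(** Near a point of [A] outside [K] all the points leave [N] before a common time; those that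
    lie on an orbit through [S] are reached from [S] in bounded time. *)
Lemma section_past_compact : compact section_past.
Proof.
apply: (subclosed_compact _ cN); last first.
  by move=> x /section_past_asymptotic; exact: asymptotic_sub.
move=> y cly; have [Ky|nKy] := pselect (K y); first by left.
have Ay : A y.
  apply: (asymptotic_closed phi_flow B); apply: closure_subset cly.
  exact: section_past_asymptotic.
have [t t0 [u /andP[u0 _] Lu]] := asymptotic_leaves phi_flow B Ay nKy.
have [r /andP[r0 _]] := exit_leaves B Lu (@ltr01 R); rewrite flowD// => nN.
have [|[s v] /= [Ss]] := @segment_image (- (u + r)) 0 y _.
  move=> V nV; have nV' := @filterI _ _ (nbhs_filter y) _ _ nV (near_flow_leave phi_flow clN nN).
  have [x [Wx [Vx nNx]]] := cly _ nV'.
  exists x; split=> //; case: Wx => [Kx|[s [v [Ss v0 xE]]]].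
    exfalso; apply: nNx; exact: (isolated_sub B (invariantP (u + r) invK Kx)).
  exists (s, v) => //; split=> //=; rewrite in_itv/= v0 andbT leNgt; apply/negP => vur.
  apply: nNx; rewrite xE flowD//; apply: S_asymptotic => //.
  by rewrite -lerBrDr sub0r ltW.
by rewrite in_itv/= => /andP[_ v0] <-; right; exists s, v.
Qed.

Variable c : R.
Hypothesis c0 : 0 <= c.
Hypothesis S_exits : forall s, S s -> hits phi L s c.

(** What has to be collapsed for the image of [A] to become the quotient by [S] of its past:
    the exit set, and the part of [A] beyond [S]. *)
Definition section_future : set E := L `|` (phi @` (S `*` `[0, c]%classic) `&` A).

Lemma section_future_closed : closed section_future.
Proof.
apply: closedU => //; apply: closedI; first exact: segment_image.
exact: (asymptotic_closed phi_flow B).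
Qed.

Lemma future_time s r : S s -> 0 <= r -> A (phi (s, r)) ->
  section_future (phi (s, r)) /\ hits phi L (phi (s, r)) c.
Proof.
move=> Ss r0 Ar; have [u /andP[u0 uc] Lu] := S_exits Ss.
have ru := asymptotic_hits phi_flow B Ar Lu.
split; first by right; split=> //; exists (s, r) => //; split=> //=; rewrite in_itv/= r0 (le_trans ru).
exists (u - r); last by rewrite flowD// addrC subrK.
by rewrite subr_ge0 ru/= lerBlDr (le_trans uc)// lerDl.
Qed.

Lemma past_or_future x : A x ->
  section_past x \/ section_future x /\ hits phi L x c.
Proof.
move=> Ax; have [Kx|nKx] := pselect (K x); first by left; left.
have [s [r [Ss xE]]] := S_meets Ax nKx; have [r0|r0] := leP r 0.
  by left; right; exists s, r.
by right; rewrite xE; apply: future_time => //; [exact: ltW|rewrite -xE].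
Qed.

Lemma past_future x : section_past x -> (section_future x <-> S x).
Proof.
move=> Wx; split=> [|Sx]; last first.
  have [||F _] := @future_time x 0 Sx; rewrite ?flow0//; first exact: S_asymptotic.
  by move: F; rewrite flow0.
case: Wx => [Kx|[s [r [Ss r0 ->]]]].
  move=> [Lx|[[[s u] [/= Ss _] xE] _]].
    have [_ []] := exit_sub B Lx; exact: (isolated_interior B).
  by exfalso; apply: (S_isolated Ss); apply/(@invariant_iff _ _ _ phi_flow _ _ u invK); rewrite xE.
move=> [Lr|[[[s' u] [/= Ss' u0] xE] _]].
  have : 0 <= r.
    by apply: (asymptotic_hits phi_flow B _ Lr); rewrite flow0//; exact: S_asymptotic.
  move=> r0'; have -> : r = 0 by apply: le_anti; rewrite r0 r0'.
  by rewrite flow0.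
have sE : s = phi (s', u - r) by rewrite -flowD// xE flowK.
have Sur : S (phi (s', u - r)) by rewrite -sE.
have ur := section_return_time Ss' Sur.
have {u0}u0 : 0 <= u by move: u0; rewrite in_itv => /andP[].
have -> : r = 0 by lra.
by rewrite flow0.
Qed.

Variables qL qD : E -> Q.
Hypotheses (qL_continuous : continuous qL) (qD_continuous : continuous qD).
Hypothesis qL0 : forall x, qL x = cube0 <-> L x.
Hypothesis qD0 : forall x, qD x = cube0 <-> section_future x.
Hypothesis qL_inj : forall x y, ~ L x -> qL x = qL y -> x = y.
Hypothesis qD_inj : forall x y, ~ section_future x -> qD x = qD y -> x = y.
Local Notation X := (pointed_image N qL cube0).
Local Notation W := section_past.
Local Notation Y := (pointed_image W qD cube0).
Local Notation stopL := (run phi L qL cube0).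
Local Notation stopD := (run phi L qD cube0).

Let qD_L x : L x -> qD x = cube0.
Proof. by move=> Lx; apply/qD0; left. Qed.

Let qL_L x : L x -> qL x = cube0. Proof. by move/qL0. Qed.

Let stopL_block x t : N x -> X (stopL (x, t)).
Proof.
move=> Nx; rewrite run_max; have t0 : 0 <= Num.max t 0 by rewrite le_max lexx orbT.
have [h|nh] := pselect (hits phi L x (Num.max t 0)).
  by rewrite run_hits//; right.
rewrite run_free//; left; exists (phi (x, Num.max t 0)) => //.
by apply: (free_stays phi_flow B Nx nh); rewrite t0 lexx.
Qed.

Let qD_asymptotic x : A x -> Y (qD x).
Proof.
move=> /past_or_future[Wx|[Dx _]]; first by left; exists x.
by right; apply/qD0.
Qed.

Let stopD_asymptotic x t : A x -> Y (stopD (x, t)).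
Proof.
move=> Ax; rewrite run_max; have t0 : 0 <= Num.max t 0 by rewrite le_max lexx orbT.
have [h|nh] := pselect (hits phi L x (Num.max t 0)).
  by rewrite run_hits//; right.
rewrite run_free//; apply: qD_asymptotic.
exact: (asymptotic_free phi_flow B).
Qed.

Let stopD_section s t : S s -> stopD (s, t) = cube0.
Proof.
move=> Ss; rewrite run_max; have t0 : 0 <= Num.max t 0 by rewrite le_max lexx orbT.
have [h|nh] := pselect (hits phi L s (Num.max t 0)); first by rewrite run_hits.
rewrite run_free//; apply/qD0; apply: (future_time Ss t0 _).1.
by apply: (asymptotic_free phi_flow B) => //; exact: S_asymptotic.
Qed.

Let qL_fibre (Z : Type) (u : E -> Z) b x y t : (forall y, L y -> u y = b) ->
  qL x = qL y -> run phi L u b (x, t) = run phi L u b (y, t).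
Proof.
move=> uL xy; have [Lx|nLx] := pselect (L x); last by rewrite (qL_inj nLx xy).
by rewrite !run_start//; apply/qL0; rewrite -xy; exact/qL0.
Qed.

Let qD_fibre x y : W x -> W y -> qD x = qD y -> x = y \/ S x /\ S y.
Proof.
move=> Wx Wy xy; have [Dx|nDx] := pselect (section_future x).
  right; split; apply/past_future => //; apply/qD0; rewrite -?xy; exact/qD0.
by left; exact: qD_inj xy.
Qed.

(** In the notation of [shape_shift_equivalence], the semiflows are the flow stopped at [L],
    on the block seen through [qL] and on the past of [S] seen through [qD].  The map [G]
    follows the past of [S] for the time [c]; as this brings [S] to the exit set, it is
    well defined on the quotient by [S]. *)
Theorem block_section_equivalent :
  fundamental_equivalent X cube0 Y cube0.
Proof.
have cW := section_past_compact.
have WA := section_past_asymptotic.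
have WN : W `<=` N by move=> x /WA; exact: asymptotic_sub.
have S_W x : W x -> qD x = cube0 -> S x by move=> Wx /qD0; exact: (past_future Wx).1.
have cLrun : {within N `*` [set: R], continuous stopL} by exact: (run_continuous phi_flow B).
have cDrun : {within N `*` [set: R], continuous stopD} by exact: (run_continuous phi_flow B).
have sub_within (u : E * R -> Q) : {within N `*` [set: R], continuous u} ->
    {within W `*` [set: R], continuous u}.
  move=> /continuous_within_near cu; apply/continuous_within_near => -[x t] [Wx _] O nO.
  have := cu (x, t) (conj (WN _ Wx) Logic.I) O nO.
  by apply: filterS => p h [Wp _]; apply: h; split=> //; exact: WN.
have [Phi [cPhi PhiE Phi0]] := @descent R E N qL cube0 Q stopL cube0 cN qL_continuous cLrun
  (fun x y t _ _ => @qL_fibre _ qL cube0 x y t qL_L)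
  (fun x t _ q0 => @run_start _ _ _ phi_flow _ L qL cube0 x t ((qL0 x).1 q0)).
have [H [cH HE H0]] := @descent R E N qL cube0 Q stopD cube0 cN qL_continuous cDrun
  (fun x y t _ _ => @qL_fibre _ qD cube0 x y t qD_L)
  (fun x t _ q0 => @run_start _ _ _ phi_flow _ L qD cube0 x t ((qL0 x).1 q0)).
have [|||M [cM ME M0]] := @descent R E W qD cube0 Q stopD cube0 cW qD_continuous.
- exact: sub_within.
- by move=> x y t Wx Wy /(qD_fibre Wx Wy)[->//|[Sx Sy]]; rewrite !stopD_section.
- by move=> x t Wx /(S_W _ Wx)/stopD_section.
have stopL_section s : S s -> stopL (s, c) = cube0.
  by move=> Ss; apply: run_hits => //; exact: S_exits.
(* [G] is obtained on [Y] by descent of a family that does not depend on time, and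
   extended to the cube. *)
have [|||U [cU UE U0]] := @descent R E W qD cube0 Q (fun p => stopL (p.1, c)) cube0 cW
    qD_continuous.
- apply/continuous_within_near => -[x t] [Wx _] O nO.
  have /continuous_within_near/(_ (x, c) (conj (WN _ Wx) Logic.I) O nO) := cLrun.
  move=> [[V C] /= [nV nC] VC].
  have nV' : \forall p \near (x, t), V p.1 by exact: (@continuous_fstT E R (x, t) V nV).
  apply: filterS nV' => -[x' t'] /= Vx' [Wx' _]; apply: (VC (x', c)).
    by split=> //=; exact: nbhs_singleton nC.
  by split=> //; exact: WN.
- by move=> x y t Wx Wy /(qD_fibre Wx Wy)[->//|[Sx Sy]] /=; rewrite !stopL_section.
- by move=> x t Wx /(S_W _ Wx)/stopL_section.
have [||||G cG GE] := @cube_extension R Q Y (fun y => U (y, 0)).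
- exact: cube_hausdorff.
- exact: cube_compact.
- exact: compact_closed cube_hausdorff (pointed_image_compact cW qD_continuous).
- apply: (@continuous_compose _ _ _ (fun y => (y, 0)) U) => //.
  exact: continuous_pair (@continuous_idT _) (@continuous_const _ _ 0).
have Yb : Y cube0 by right.
have Gb : G cube0 = cube0.
  by rewrite -[in LHS](_ : set_val (point_of Yb) = cube0)// GE U0.
(* Beyond [S] both sides are the base point, since the orbit meets [L] before [c]. *)
have Gq x : A x -> G (qD x) = stopL (x, c).
  move=> /past_or_future[Wx|[Dx hx]]; last by rewrite (qD0 x).2// Gb run_hits.
  have Yx : Y (qD x) by left; exists x.
  by rewrite -[qD x]/(set_val (point_of Yx)) GE (UE x).
have Xcase (p : X) : (exists2 x, N x & set_val p = qL x) \/ set_val p = cube0.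
  by have [[x Nx xp]|] := set_valP p; [left; exists x|right].
have Ycase (p : Y) : (exists2 x, W x & set_val p = qD x) \/ set_val p = cube0.
  by have [[x Wx xp]|] := set_valP p; [left; exists x|right].
apply: (@shape_shift_equivalence R X cube0 Y cube0 c H Phi G M) => //.
- exact: pointed_image_compact.
- exact: pointed_image_compact.
- by right.
- move=> y [[x Wx <-]|->]; last by rewrite Gb; right.
  by rewrite Gq; [exact/stopL_block/WN|exact: WA].
- move=> V nV; have [|T [T0 HT]] := @asymptotic_attraction _ _ phi phi_flow K N L L' B (V \o qD).
    move=> y Ay; have : nbhs y (V \o qD).
      by apply: qD_continuous; exact/nV/qD_asymptotic.
    by apply: filterS => z Vz _.
  exists T => p t Tt; have t0 := le_trans T0 Tt.
  have Vb : V cube0 by exact: nbhs_singleton (nV _ Yb).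
  have [[x Nx px]|pb] := Xcase p; last by rewrite H0.
  rewrite (HE x)//; have [h|nh] := pselect (hits phi L x t).
    by rewrite run_hits.
  by rewrite run_free//; exact: HT.
- move=> p t; have [[x Nx px]|pb] := Xcase p; last by rewrite Phi0//; right.
  by rewrite (PhiE x)//; exact: stopL_block.
- move=> p; have [[x Nx px]|pb] := Xcase p; last by rewrite Phi0.
  by rewrite (PhiE x)// run0.
- move=> p t; have [[x Wx px]|pb] := Ycase p; last by rewrite M0//; right.
  by rewrite (ME x)//; exact/stopD_asymptotic/WA.
- move=> p; have [[x Wx px]|pb] := Ycase p; last by rewrite M0.
  by rewrite (ME x)// run0.
- move=> k p p' p'E; have [[x Wx px]|pb] := Ycase p; last first.
    by rewrite M0// H0// p'E pb.
  rewrite (ME x)//; rewrite px Gq in p'E; last exact: WA.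
  have [h|nh] := pselect (hits phi L x c).
    rewrite run_hits ?addr_ge0// ?H0 ?p'E ?run_hits//.
    by apply: hits_le h; rewrite lerDl.
  rewrite runD//; rewrite run_free// in p'E; rewrite (HE (phi (x, c)))//.
  by apply: (free_stays phi_flow B (WN _ Wx) nh); rewrite c0 lexx.
- move=> V nV.
  pose seg (p : (Q * Q) * unit_itv R) : Q := fun m =>
    clamp ((1 - set_val p.2) * set_val (p.1.1 m) + set_val p.2 * set_val (p.1.2 m)).
  have cseg : continuous seg.
    have cv : continuous (fun p : (Q * Q) * unit_itv R => set_val p.2).
      exact: continuous_compose (@continuous_sndT _ _) (@continuous_set_val _ _).
    apply: continuous_clamp_cube => m; apply: continuous_addR; apply: continuous_mulR => //.
    - exact: continuous_subR (@continuous_const _ _ _) cv.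
    - apply: (@continuous_compose _ _ _ (fun p : (Q * Q) * unit_itv R => p.1.1)
        (fun q : Q => set_val (q m))); last exact: continuous_coord.
      exact: continuous_compose (@continuous_fstT _ _) (@continuous_fstT _ _).
    - apply: (@continuous_compose _ _ _ (fun p : (Q * Q) * unit_itv R => p.1.2)
        (fun q : Q => set_val (q m))); last exact: continuous_coord.
      exact: continuous_compose (@continuous_fstT _ _) (@continuous_sndT _ _).
  have seg_diag z s : seg ((z, z), s) = z.
    apply: functional_extensionality_dep => m.
    by rewrite /seg /= -mulrDl subrK mul1r; exact: set_valK.
  have [|T [T0 HT]] := @asymptotic_attraction _ _ phi phi_flow K N L L' B
      (fun y => forall s, V (seg ((G (qD y), stopL (y, c)), s))).
    move=> y Ay; pose z := stopL (y, c).
    have Xz : X z by exact/stopL_block/(asymptotic_sub phi_flow Ay).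
    have nseg : \forall ab \near (z, z), forall s, V (seg (ab, s)).
      apply: near_forall_compact unit_itv_compact cseg _ => s.
      by rewrite seg_diag; exact: nV.
    have [[V1 V2] /= [nV1 nV2] V12] := nseg.
    have /continuous_within_near cLn := cLrun.
    have [[U1 U2] /= [nU1 nU2] U12] := cLn (y, c)
      (conj (asymptotic_sub phi_flow Ay) Logic.I) V2 nV2.
    have nGy : nbhs y (fun y' => V1 (G (qD y'))).
      apply: (continuous_compose qD_continuous cG).
      by rewrite Gq.
    apply: filterS2 nGy nU1 => y' V1y' U1y' Ny' s.
    apply: (V12 (G (qD y'), stopL (y', c))); split=> //=.
    apply: (U12 (y', c)) => //; split=> //=; exact: nbhs_singleton nU2.
  exists T => p t Tt s; have t0 := le_trans T0 Tt.
  have Xb : X cube0 by right.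
  have Vb : V cube0 by exact: nbhs_singleton (nV _ Xb).
  rewrite -/(seg ((G (H (p, t)), Phi (p, c + t)), s)).
  have [[x Nx px]|pb] := Xcase p; last by rewrite H0// Phi0// Gb seg_diag.
  rewrite (HE x)// (PhiE x)//; have [h|nh] := pselect (hits phi L x t).
    rewrite !run_hits ?addr_ge0// ?Gb ?seg_diag//.
    by apply: hits_le h; rewrite lerDr.
  by rewrite run_free// addrC runD//; exact: HT.
Qed.

End core.

(** * Initial parts of the unstable manifold *)

Section initial_part.
Context {R : realType} {n : nat}.
Local Notation E := 'rV[R]_n.
Local Notation Q := (hilbert_cube R).
Variables (phi : E * R -> E) (K N L L' S : set E).
Hypothesis phi_flow : is_flow phi.
Hypothesis B : isolating_block phi K N L L'.
Hypothesis S_section : initial_section phi K S.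
Local Notation A := (asymptotic phi N).

Let invK : invariant_set phi K. Proof. exact: isolated_invariant B. Qed.

Let S_compact : compact S. Proof. by case: S_section => -[]. Qed.

Let orbit_exterior x : unstable_manifold phi K x -> ~ K x ->
  flow_image phi [set x] setT `<=` unstable_manifold phi K `\` K.
Proof.
move=> Wx nKx _ [[_ t] [/= -> _] <-]; split; first exact: (unstable_flow phi_flow).
by move/(@invariant_iff _ _ _ phi_flow _ _ t invK).
Qed.

Lemma initial_section_meets x : unstable_manifold phi K x -> ~ K x ->
  exists s r, S s /\ x = phi (s, r).
Proof.
move=> Wx nKx; case: S_section => -[_ _ hS] _.
have [s [[Ss [[_ t] [/= -> _] sE]] _]] := hS x (orbit_exterior Wx nKx).
by exists s, (- t); split=> //; rewrite -sE flowK.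
Qed.

Lemma initial_section_once s s' r : S s -> S s' -> s' = phi (s, r) -> s = s'.
Proof.
move=> Ss Ss' s'E; case: S_section => -[_ SW hS] _.
have [Ws nKs] := SW s Ss.
have [z [_ zu]] := hS s (orbit_exterior Ws nKs).
rewrite -(zu s) ?(zu s')//; split=> //.
  by exists (s, r).
by exists (s, 0) => //; rewrite flow0.
Qed.

Lemma initial_section_shift : exists2 T, 0 <= T & forall s, S s -> A (phi (s, - T)).
Proof.
case: S_section => -[_ SW _] SK.
have [T [T0 hT]] := section_enters phi_flow B (fun s Ss => (SW s Ss).1) SK.
exists T => // s Ss t t0; rewrite flowD//; apply: hT => //.
by rewrite gerDl.
Qed.

Variable T : R.
Hypothesis S_shift : forall s, S s -> A (phi (s, - T)).

(** The translate of [S] by the time [- T], as a preimage so that membership is a statement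
    about [S] *)
Definition shifted_section : set E := [set x | S (phi (x, T))].
Local Notation S0 := shifted_section.

Lemma shiftedP s : S s <-> S0 (phi (s, - T)).
Proof. by rewrite /shifted_section /= flowD// addNr flow0. Qed.

Lemma shifted_section_image : S0 = (fun x => phi (x, - T)) @` S.
Proof.
apply/seteqP; split=> [x S0x|_ [s Ss <-]]; last exact: (shiftedP s).1.
by exists (phi (x, T)) => //; rewrite flowK.
Qed.

Lemma shifted_compact : compact S0.
Proof.
rewrite shifted_section_image; apply: continuous_compact S_compact.
exact/continuous_subspaceT/flow_continuous_l.
Qed.

Lemma shifted_asymptotic : S0 `<=` A.
Proof. by rewrite shifted_section_image => _ [s Ss <-]; exact: S_shift. Qed.

Lemma shifted_isolated x : S0 x -> ~ K x.
Proof.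
move=> Sx Kx; case: S_section => -[_ SW _] _.
by have [_] := SW _ Sx; apply; exact: (invariantP _ invK Kx).
Qed.

Lemma shifted_meets x : A x -> ~ K x -> exists s r, S0 s /\ x = phi (s, r).
Proof.
move=> Ax nKx.
have [s [r [Ss xE]]] := initial_section_meets (asymptotic_unstable phi_flow B Ax) nKx.
exists (phi (s, - T)), (T + r); split; first exact: (shiftedP s).1.
by rewrite flowD// addrA addNr add0r.
Qed.

Lemma shifted_once s s' r : S0 s -> S0 s' -> s' = phi (s, r) -> s = s'.
Proof.
move=> Ss Ss' s'E; have : phi (s, T) = phi (s', T).
  by apply: (@initial_section_once _ _ r) => //; rewrite s'E !flowD// addrC.
by move=> e; rewrite -(flowK phi_flow s T) e flowK.
Qed.

Local Notation W0 := (section_past phi K S0).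

Lemma initial_part_shift x : initial_part phi K S x <-> W0 (phi (x, - T)).
Proof.
split=> [[[[s r] [/= Ss r0] <-]|Kx]|[Kx|[s [r [Ss r0 xE]]]]].
- right; exists (phi (s, - T)), r; split; first exact: (shiftedP s).1.
    by move: r0; rewrite in_itv.
  by rewrite !flowD// addrC.
- by left; exact: (invariantP _ invK Kx).
- by right; apply/(@invariant_iff _ _ _ phi_flow _ _ (- T) invK).
- left; exists (phi (s, T), r); first by split=> //=; rewrite in_itv.
  by rewrite /= flowD// addrC -flowD// -xE flowD// addNr flow0.
Qed.

Lemma initial_part_compact : compact (initial_part phi K S).
Proof.
have -> : initial_part phi K S = (fun x => phi (x, T)) @` W0.
  apply/seteqP; split=> [x /initial_part_shift Wx|_ [x Wx <-]].
    by exists (phi (x, - T)) => //; rewrite flowD// addNr flow0.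
  by apply/initial_part_shift; rewrite flowK.
apply: continuous_compact; first exact/continuous_subspaceT/flow_continuous_l.
exact: (section_past_compact phi_flow B shifted_compact shifted_asymptotic).
Qed.

Variable c : R.
Hypothesis S0_exits : forall s, S0 s -> hits phi L s c.
Local Notation D := (section_future phi N L S0 c).

Let past_future_S0 x : W0 x -> (D x <-> S0 x).
Proof.
exact: (past_future phi_flow B shifted_asymptotic shifted_isolated shifted_once S0_exits).
Qed.

Let return_time s r : S0 s -> S0 (phi (s, r)) -> r = 0.
Proof.
exact: (section_return_time phi_flow B shifted_asymptotic shifted_isolated shifted_once).
Qed.

Lemma strict_past x r : W0 x -> r < 0 -> W0 (phi (x, r)) /\ ~ D (phi (x, r)).
Proof.
move=> Wx r0; have Wr : W0 (phi (x, r)).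
  case: Wx => [Kx|[s [t [Ss t0 ->]]]]; first by left; exact: (invariantP _ invK Kx).
  by right; exists s, (t + r); split=> //; [lra|rewrite flowD].
split=> // /(past_future_S0 Wr) Sr.
case: Wx Sr => [Kx|[s [t [Ss t0 ->]]]] Sr.
  by apply: (shifted_isolated Sr); exact: (invariantP _ invK Kx).
by rewrite flowD// in Sr; have := return_time Ss Sr; lra.
Qed.

Variable qD : E -> Q.
Hypothesis qD_continuous : continuous qD.
Hypothesis qD0 : forall x, qD x = cube0 <-> D x.
Hypothesis qD_inj : forall x y, ~ D x -> qD x = qD y -> x = y.
Local Notation W := (set_type (initial_part phi K S)).
Local Notation SW := [set x : W | S (set_val x)].

Let flow_inj x y t : phi (x, t) = phi (y, t) -> x = y.
Proof. by move=> e; rewrite -(flowK phi_flow x t) e flowK. Qed.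

Let past_W (w : W) : W0 (phi (set_val w, - T)).
Proof. by apply/initial_part_shift; exact: set_valP. Qed.

(** The homeomorphism [phi (_, - T)] carries the initial part to the past of the translated
    section, and [S] to that section. *)
Lemma initial_part_collapse : compact [set: collapse SW] /\
  exists i : collapse SW -> Q, [/\ cube_embedding i,
    range i = pointed_image W0 qD cube0 & i (collapse_base SW) = cube0].
Proof.
pose q (w : W) := qD (phi (set_val w, - T)).
have cq : continuous q.
  apply: (@continuous_compose _ _ _ (fun w : W => phi (set_val w, - T)) qD) => //.
  exact: continuous_compose (@continuous_set_val _ _)
    (@flow_continuous_l _ _ _ phi_flow (- T)).
have [|||ck [i [ei ri bi _]]] := @collapse_embedding R W SW q cube0 _ cq.
- exact/compact_set_type/initial_part_compact.
- move=> w; split=> [/qD0 Dw|Sw].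
    exact: ((shiftedP _).2 ((past_future_S0 (past_W w)).1 Dw)).
  exact: ((qD0 _).2 ((past_future_S0 (past_W w)).2 ((shiftedP _).1 Sw))).
- move=> w w' /= nSw ww'; apply/val_inj/(@flow_inj _ _ (- T))/qD_inj => //.
  by move=> Dw; apply: nSw; exact: ((shiftedP _).2 ((past_future_S0 (past_W w)).1 Dw)).
split=> //; exists i; split=> //; rewrite ri; congr (_ `|` _).
apply/seteqP; split=> [_ [w _ <-]|_ [x Wx <-]]; first by exists (phi (set_val w, - T)).
have Wx' : initial_part phi K S (phi (x, T)) by apply/initial_part_shift; rewrite flowK.
by exists (point_of Wx') => //; rewrite /q /= flowK.
Qed.

(** The initial part is translated by one more unit of time, which leaves room for the
    orbit segments of length [1] that end on the translated section: they form the cone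
    over [S], with its top on the section, which [qD] collapses. *)
Lemma initial_part_cone : compact [set: attach_cone R W SW] /\
  exists i : attach_cone R W SW -> Q, [/\ cube_embedding i,
    range i = pointed_image W0 qD cube0 & i (attach_cone_vertex R W SW) = cube0].
Proof.
pose q (w : W) := qD (phi (set_val w, - T - 1)).
pose k (p : (set_type SW * unit_itv R)%type) :=
  qD (phi (set_val (set_val p.1), set_val p.2 - 1 - T)).
have qE w : q w = qD (phi (phi (set_val w, - T), - 1)) by rewrite /q flowD.
have kE a t : k (a, t) = qD (phi (phi (set_val (set_val a), - T), set_val t - 1)).
  by rewrite /k flowD//= addrC.
have cq : continuous q.
  apply: (@continuous_compose _ _ _ (fun w : W => phi (set_val w, - T - 1)) qD) => //.
  exact: continuous_compose (@continuous_set_val _ _)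
    (@flow_continuous_l _ _ _ phi_flow (- T - 1)).
have ck : continuous k.
  apply: (@continuous_compose (set_type SW * unit_itv R)%type (E * R)%type Q
    (fun p => (set_val (set_val p.1), set_val p.2 - 1 - T)) (fun p => qD (phi p))).
    apply: continuous_pair.
      have cvv : continuous (fun a : set_type SW => set_val (set_val a)).
        exact: continuous_compose (@continuous_set_val _ _) (@continuous_set_val _ _).
      exact: continuous_compose (@continuous_fstT _ _) cvv.
    apply: continuous_subR; last exact: continuous_const.
    apply: continuous_subR; last exact: continuous_const.
    exact: continuous_compose (@continuous_sndT _ _) (@continuous_set_val _ _).
  exact: continuous_compose (flow_continuous phi_flow) qD_continuous.
have cSW : compact SW.
  apply: (subclosed_compact _ (compact_set_type initial_part_compact)) => //.
  apply: closed_comp (compact_closed (@norm_hausdorff _ _) S_compact) => w _.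
  exact: continuous_set_val.
have N10 : (-1 : R) < 0 by lra.
have S0a (a : set_type SW) : S0 (phi (set_val (set_val a), - T)).
  by apply: (shiftedP _).1; exact: (set_valP a).
have S0_W0 x : S0 x -> W0 x by move=> Sx; apply: section_sub_past.
have nD_cone (a : set_type SW) (t : unit_itv R) : set_val t <> 1 ->
    ~ D (phi (phi (set_val (set_val a), - T), set_val t - 1)).
  move=> t1; have /andP[_ t1'] := unit_itvP t.
  have t1'' : set_val t < 1 by rewrite lt_neqAle t1' andbT; apply/eqP.
  by apply: (strict_past (S0_W0 _ (S0a a)) _).2; lra.
have [|||||||] := @attach_cone_embedding R W SW q k cube0 _ cSW cq ck.
- exact/compact_set_type/initial_part_compact.
- move=> w w'; rewrite !qE => /qD_inj => h.
  apply/val_inj/(@flow_inj _ _ (- T))/(@flow_inj _ _ (- 1))/h.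
  exact: (strict_past (past_W w) N10).2.
- by move=> w; rewrite qE => /qD0; exact: (strict_past (past_W w) N10).2.
- by move=> a t t0; rewrite kE qE t0 sub0r.
- move=> a t; rewrite kE; split=> [/qD0 Da|->].
    by apply: contrapT => /nD_cone/(_ Da).
  apply/qD0; rewrite subrr flow0//; apply/past_future_S0 => //; exact: S0_W0.
- move=> [a t] [a' t'] /= t1; rewrite !kE => /(qD_inj (nD_cone a t t1)) e.
  have s'E : phi (set_val (set_val a'), - T) =
      phi (phi (set_val (set_val a), - T), set_val t - 1 - (set_val t' - 1)).
    by rewrite -[RHS]flowD// e flowK.
  have ss' := shifted_once (S0a a) (S0a a') s'E.
  have := S0a a'; rewrite s'E => /(return_time (S0a a)) tt'.
  congr pair; first by do 2 apply: val_inj; exact: flow_inj ss'.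
  by apply: unit_itv_inj; lra.
- move=> w a t; rewrite qE kE => /(qD_inj (strict_past (past_W w) N10).2) e.
  have yE : phi (set_val w, - T) = phi (phi (set_val (set_val a), - T), set_val t).
    by rewrite -(flowK phi_flow (phi (set_val w, - T)) (- 1)) e flowD// opprK subrK.
  have /andP[t0 _] := unit_itvP t.
  case: (past_W w) => [Ky|[s [r [Ss r0 ysr]]]].
    exfalso; apply: (shifted_isolated (S0a a)).
    by apply/(@invariant_iff _ _ _ phi_flow _ _ (set_val t) invK); rewrite -yE.
  have sE : s = phi (phi (set_val (set_val a), - T), set_val t - r).
    by rewrite -[RHS]flowD// -yE ysr flowK.
  have := Ss; rewrite sE => /(return_time (S0a a)) tr.
  have te : set_val t = 0 by lra.
  split=> //; apply/val_inj/(@flow_inj _ _ (- T)).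
  by rewrite yE te flow0.
move=> cac [i [ei ri bi]]; split=> //; exists i; split=> //.
rewrite ri; congr (_ `|` _); apply/seteqP; split=> [_ [[w _ <-]|[[a t] _ <-]]|_ [x Wx <-]].
- by rewrite qE; eexists; [exact: (strict_past (past_W w) N10).1|].
- rewrite kE; exists (phi (phi (set_val (set_val a), - T), set_val t - 1)) => //.
  have /andP[_ t1] := unit_itvP t; right.
  by exists (phi (set_val (set_val a), - T)), (set_val t - 1); split=> //; lra.
- have W_of y : W0 y -> initial_part phi K S (phi (y, T)).
    by move=> Wy; apply/initial_part_shift; rewrite flowK.
  (* Points that stay in the past for one more unit of time come from [W], the others
     from the cone. *)
  have old : W0 (phi (x, 1)) -> (range q `|` range k) (qD x).
    move=> Wx1; left; exists (point_of (W_of _ Wx1)) => //.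
    by rewrite qE /= flowK// flowK.
  case: (Wx) => [Kx|[s [r [Ss r0 xE]]]]; first by apply: old; left; exact: (invariantP _ invK Kx).
  have [r1|r1] := leP r (- 1).
    by apply: old; right; exists s, (r + 1); split=> //; [lra|rewrite xE flowD].
  have Ws := W_of _ (S0_W0 _ Ss).
  have Sa : SW (point_of Ws) by [].
  have t01 : 0 <= r + 1 <= 1 by apply/andP; split; lra.
  right; exists (point_of Sa, clamp (r + 1)) => //.
  by rewrite kE clampK// addrK /= flowK// -xE.
Qed.

End initial_part.

(** * The shape index *)

Lemma block_collapse_embedding (R : realType) (n : nat) (phi : 'rV[R]_n * R -> 'rV[R]_n)
    (K N L L' : set 'rV[R]_n) (qL : 'rV[R]_n -> hilbert_cube R) :
  isolating_block phi K N L L' -> continuous qL ->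
  (forall x, qL x = cube0 <-> L x) -> (forall x y, ~ L x -> qL x = qL y -> x = y) ->
  let L1 := [set x : set_type N | L (set_val x)] in
  compact [set: collapse L1] /\
  exists i : collapse L1 -> hilbert_cube R, [/\ cube_embedding i,
    range i = pointed_image N qL cube0 & i (collapse_base L1) = cube0].
Proof.
move=> B cq q0 qi L1.
have cN : compact N := block_compact B.
have [||||ck [i [ei ri bi _]]] :=
    @collapse_embedding R (set_type N) L1 (fun x => qL (set_val x)) cube0.
- exact: compact_set_type.
- exact: continuous_compose (@continuous_set_val _ _) cq.
- by move=> x; exact: q0.
- by move=> x y nLx /(qi _ _ nLx)/val_inj.
split=> //; exists i; split=> //; rewrite ri; congr (_ `|` _).
apply/seteqP; split=> [_ [x _ <-]|_ [x Nx <-]].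
  by exists (set_val x) => //; exact: set_valP.
by exists (point_of Nx).
Qed.

Theorem theorem1p2 (R : realType) (n : nat) (phi : 'rV[R]_n * R -> 'rV[R]_n)
    (K S : set 'rV[R]_n)
    (phi_flow : is_flow phi)
    (K_isolated : isolated_invariant_set phi K)
    (K_finite_type : finite_type (set_type K))
    (S_section : initial_section phi K S) :
  let W := initial_part phi K S in
  let S' := [set x : set_type W | S (set_val x)] in
  shape_index_is phi K (collapse S') (collapse_base S') /\
  shape_index_is phi K (attach_cone R (set_type W) S')
    (attach_cone_vertex R (set_type W) S').
Proof.
move=> W S'.
suff main N L L' : isolating_block phi K N L L' ->
    let L1 := [set x : set_type N | L (set_val x)] in
    same_shape R (collapse L1) (collapse_base L1) (collapse S') (collapse_base S') /\
    same_shape R (collapse L1) (collapse_base L1) (attach_cone R (set_type W) S')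
      (attach_cone_vertex R (set_type W) S').
  by split=> N L L' B; case: (main N L L' B).
move=> B L1.
have [T _ ST] := initial_section_shift phi_flow B S_section.
have S0c : compact (shifted_section phi S T) := shifted_compact phi_flow S_section (T := T).
have S0A := shifted_asymptotic phi_flow ST.
have S0K := shifted_isolated B S_section (T := T).
have S0m := @shifted_meets _ _ _ _ _ _ _ _ phi_flow B S_section T.
have S0o := @shifted_once _ _ _ _ _ _ _ _ phi_flow B S_section T.
have [c c0 Sc] := section_exit_bound phi_flow B S0c S0A S0K.
have clL : closed L := compact_closed (@norm_hausdorff _ _) (block_exit_compact B).
have [qL [cqL qL0 qLi]] := collapsing_map clL.
have clD : closed (section_future phi N L (shifted_section phi S T) c).
  exact: (section_future_closed phi_flow B).
have [qD [cqD qD0 qDi]] := collapsing_map clD.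
have FE := block_section_equivalent phi_flow B S0c S0A S0K S0m S0o c0 Sc cqL cqD qL0 qD0 qLi qDi.
have [cL1 [i [ei ri bi]]] := block_collapse_embedding B cqL qL0 qLi.
have [cC [j [ej rj bj]]] :=
  initial_part_collapse phi_flow B S_section ST Sc cqD qD0 qDi.
have [cA [l [el rl bl]]] :=
  initial_part_cone phi_flow B S_section ST Sc cqD qD0 qDi.
split; split=> //; [exists i, j|exists i, l]; split=> //.
  by rewrite ri rj bi bj.
by rewrite ri rl bi bl.
Qed.
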